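(* Let $\Gamma=(G,\sigma)$ be a signed graph with $G=(V,E)$, $|V|=n$. For each $1\le k\le n$ and every $q\ge 1$, $$L_k(\Gamma)=\min_{B\in\mathcal F_k(\mathcal S_q)}\max_{g\in B}\mathcal R^\sigma_{q,\infty}(g),\qquad\text{where}\quad \mathcal R^\sigma_{q,\infty}(g):=\frac{\sum_{\{i,j\}\in E}w_{ij}\left(\max\{-g(i)\sigma_{ij}g(j),0\}\right)^{q/2}}{\sum_{i=1}^n\mu_i|g(i)|^q}$$ for nonzero $g:V\to\mathbb R$.
   Context: $G=(V,E)$ is a finite undirected graph without self-loops, $V=\{1,\dots,n\}$. A signed graph $\Gamma=(G,\sigma)$ has signature $\sigma:E\to\{\pm1\}$, $\sigma_{ij}=\sigma(\{i,j\})$, edge weight $w:E\to(0,\infty)$, vertex measure $\mu:V\to(0,\infty)$, potential $\kappa:V\to\mathbb R$. For $p\ge1$ and nonzero $f$, $\mathcal R_p^\sigma(f)=\frac{\sum_{\{i,j\}\in E}w_{ij}|f(i)-\sigma_{ij}f(j)|^p+\sum_i\kappa_i|f(i)|^p}{\sum_i\mu_i|f(i)|^p}$; $\mathcal S_p=\{f:\sum_i\mu_i|f(i)|^p=1\}$. The Krasnoselskii genus $\gamma(B)$ of a closed symmetric $B\subset\mathbb R^n\setminus\{0\}$ is the least $k$ with an odd continuous map $B\to\mathbb R^k\setminus\{0\}$; $\mathcal F_k(\mathcal S_p)$ = closed symmetric $B\subset\mathcal S_p$ with $\gamma(B)\ge k$. Variational eigenvalues: $\lambda_k^{(p)}(\Gamma)=\min_{B\in\mathcal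 F_k(\mathcal S_p)}\max_{f\in B}\mathcal R_p^\sigma(f)$. The cut-off adjacency eigenvalues are $L_k(\Gamma):=\lim_{p\to\infty}2^{-p}\lambda_k^{(p)}(\Gamma)$, $k=1,\dots,n$ (these limits exist and do not depend on $\kappa$). *)

(* Defs.v *)
From HB Require Import structures.
From mathcomp Require Import all_boot all_order all_algebra.
From mathcomp Require Import all_classical all_reals all_analysis.
Set Implicit Arguments. Unset Strict Implicit. Unset Printing Implicit Defensive.
Import Order.TTheory GRing.Theory Num.Theory.
Import numFieldNormedType.Exports.
Local Open Scope classical_set_scope.
Local Open Scope ring_scope.

(* Vertices are 'I_n (standing for {1,...,n}); functions f : V -> R are row
   vectors f : 'rV[R]_n, with value f ord0 i at vertex i.
   The graph is a symmetric irreflexive relation adj on 'I_n; each edge {i,j}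
   is counted once, via the representative i < j. *)

Definition edge_sum (R : realType) (n : nat) (adj : rel 'I_n)
  (F : 'I_n -> 'I_n -> R) : R :=
  \sum_(i < n) \sum_(j < n | (i < j)%N && adj i j) F i j.

Definition pnorm_p (R : realType) (n : nat) (mu : 'I_n -> R) (p : R)
  (f : 'rV[R]_n) : R :=
  \sum_(i < n) mu i * `|f ord0 i| `^ p.

Definition rayleigh_p (R : realType) (n : nat) (adj : rel 'I_n)
  (w sigma : 'I_n -> 'I_n -> R) (mu kappa : 'I_n -> R) (p : R)
  (f : 'rV[R]_n) : R :=
  (edge_sum adj (fun i j => w i j * `|f ord0 i - sigma i j * f ord0 j| `^ p)
   + \sum_(i < n) kappa i * `|f ord0 i| `^ p) / pnorm_p mu p f.

Definition rayleigh_qinf (R : realType) (n : nat) (adj : rel 'I_n)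
  (w sigma : 'I_n -> 'I_n -> R) (mu : 'I_n -> R) (q : R)
  (g : 'rV[R]_n) : R :=
  edge_sum adj (fun i j =>
      w i j * (Num.max (- (g ord0 i * sigma i j * g ord0 j)) 0) `^ (q / 2))
  / pnorm_p mu q g.

Definition sphere_p (R : realType) (n : nat) (mu : 'I_n -> R) (p : R)
  : set 'rV[R]_n := [set f | pnorm_p mu p f = 1].

Definition symmetric_set (R : realType) (n : nat) (B : set 'rV[R]_n) : Prop :=
  forall f, B f -> B (- f).

Definition genus_ge (R : realType) (n : nat) (B : set 'rV[R]_n) (k : nat)
  : Prop :=
  forall m : nat, (m < k)%N ->
    ~ exists h : 'rV[R]_n -> 'rV[R]_m,
        [/\ {within B, continuous h},
            (forall x, B x -> h (- x) = - h x) &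
            (forall x, B x -> h x != 0)].

Definition genus_family (R : realType) (n : nat) (S : set 'rV[R]_n) (k : nat)
  : set (set 'rV[R]_n) :=
  [set B | [/\ B `<=` S, closed B, symmetric_set B & genus_ge B k]].

(* lambda_k^{(p)}(Gamma) = min_{B in F_k(S_p)} max_{f in B} R_p^sigma(f)
   (written as inf/sup, which are attained) *)
Definition var_eig (R : realType) (n : nat) (adj : rel 'I_n)
  (w sigma : 'I_n -> 'I_n -> R) (mu kappa : 'I_n -> R) (k : nat) (p : R) : R :=
  inf [set sup (rayleigh_p adj w sigma mu kappa p @` B)
      | B in genus_family (sphere_p mu p) k].

Definition minmax_qinf (R : realType) (n : nat) (adj : rel 'I_n)
  (w sigma : 'I_n -> 'I_n -> R) (mu : 'I_n -> R) (k : nat) (q : R) : R :=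
  inf [set sup (rayleigh_qinf adj w sigma mu q @` B)
      | B in genus_family (sphere_p mu q) k].

(* Main.v *)
Require Import Defs.
From HB Require Import structures.
From mathcomp Require Import all_boot all_order all_algebra.
From mathcomp Require Import all_classical all_reals all_analysis.
From mathcomp Require Import lra ring.
Import Order.TTheory GRing.Theory Num.Theory.
Import numFieldNormedType.Exports.
Local Open Scope classical_set_scope.

(** After the substitution f(i) = sgn g(i) |g(i)|^(q/p), an odd homeomorphism
    from S_q onto S_p, the quotient 2^-p R_p becomes a function of g on S_q.
    On an edge where g(i) and -sigma_ij g(j) have the same sign, the summand
    is the p-th power of the mean of |g(i)|^(q/p) and |g(j)|^(q/p), which tends
    to (|g(i)||g(j)|)^(q/2); every other summand is at most a constant times
    2^-p.  Both errors are O(1/p) uniformly on S_q, and an inf-sup value moves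
    by at most the uniform distance of the functions.

    Two topological facts enter.  The family F_k(S_q) is nonempty for k <= n
    by the Borsuk-Ulam theorem, which follows from Ky Fan's counting of alternating
    simplices in iterated barycentric subdivisions of the hemispheres of the
    cross-polytope.  The minimum is attained on a sublevel set, whose genus is
    controlled by extending odd maps with Tietze's theorem. *)

Set Implicit Arguments. Unset Strict Implicit. Unset Printing Implicit Defensive.

(** * Ky Fan's parity argument *)

(* A chain over F_2 is a list of simplices (vertex lists); two chains are
   identified when [parity F] agrees on them for every [F]. *)
Definition parity (T : Type) (F : seq T -> bool) (c : seq (seq T)) : bool :=
  \big[addb/false]_(s <- c) F s.

Lemma parity_cat (T : Type) (F : seq T -> bool) c d :
  parity F (c ++ d) = parity F c (+) parity F d.
Proof. by rewrite /parity big_cat. Qed.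

Lemma parity_cons (T : Type) (F : seq T -> bool) s c :
  parity F (s :: c) = F s (+) parity F c.
Proof. by rewrite /parity big_cons. Qed.

Lemma parity_map (T U : Type) (F : seq T -> bool) (f : seq U -> seq T) c :
  parity F (map f c) = parity (F \o f) c.
Proof. by rewrite /parity big_map. Qed.

Lemma parity_flatten (T U : Type) (F : seq T -> bool) (g : seq U -> seq (seq T)) c :
  parity F (flatten (map g c)) = parity (fun s => parity F (g s)) c.
Proof. by rewrite /parity big_flatten big_map. Qed.

Lemma parityD (T : Type) (F G : seq T -> bool) c :
  parity (fun s => F s (+) G s) c = parity F c (+) parity G c.
Proof. by rewrite /parity big_split. Qed.

Lemma eq_parity (T : Type) (F G : seq T -> bool) c :
  F =1 G -> parity F c = parity G c.
Proof. by move=> FG; apply: eq_bigr => s _; exact: FG. Qed.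

Lemma eq_in_parity (T : eqType) (F G : seq T -> bool) c :
  {in c, F =1 G} -> parity F c = parity G c.
Proof. by move=> FG; apply: eq_big_seq. Qed.

Lemma parity_exists (T : eqType) (F : seq T -> bool) c :
  parity F c -> exists2 s, s \in c & F s.
Proof.
elim: c => [|s c IH]; first by rewrite /parity big_nil.
rewrite parity_cons; case Fs: (F s) => /=.
  by exists s; rewrite ?mem_head.
by move=> /IH[t tc Ft]; exists t; rewrite // inE tc orbT.
Qed.

(** A vertex has the empty simplex as its only facet, so the complex is augmented and the cone
    formula below holds in every dimension. *)
Fixpoint facets (T : Type) (s : seq T) : seq (seq T) :=
  if s is x :: t then t :: map (cons x) (facets t) else [::].

Definition bdry (T : Type) (c : seq (seq T)) := flatten (map (@facets T) c).

Lemma parity_bdry (T : Type) (F : seq T -> bool) c :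
  parity F (bdry c) = parity (fun s => parity F (facets s)) c.
Proof. exact: parity_flatten. Qed.

Lemma bdry_cat (T : Type) (c d : seq (seq T)) : bdry (c ++ d) = bdry c ++ bdry d.
Proof. by rewrite /bdry map_cat flatten_cat. Qed.

Lemma parity_facets_cons (T : Type) (F : seq T -> bool) x s :
  parity F (facets (x :: s)) = F s (+) parity (F \o cons x) (facets s).
Proof. by rewrite /= parity_cons parity_map. Qed.

Lemma parity_bdry_cone (T : Type) (F : seq T -> bool) x c :
  parity F (bdry (map (cons x) c)) =
  parity F c (+) parity (F \o cons x) (bdry c).
Proof.
rewrite !parity_bdry parity_map.
rewrite -parityD; apply: eq_parity => s /=.
exact: parity_facets_cons.
Qed.

(** By the cone formula, [s] and the cone over [facets s] both contribute [facets s], which cancels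
    mod 2; what remains is a cone over a double boundary. *)
Lemma bdry_bdry (T : Type) (F : seq T -> bool) s :
  parity F (bdry (facets s)) = false.
Proof.
elim: s F => [|x s IH] F; first by rewrite /bdry/= /parity big_nil.
rewrite /= /bdry [map _ (_ :: _)]/= [flatten _]/= parity_cat -/(bdry _).
by rewrite parity_bdry_cone IH addbF addbb.
Qed.

Lemma facets_map (T U : Type) (f : T -> U) s :
  facets (map f s) = map (map f) (facets s).
Proof.
by elim: s => //= x s ->; rewrite -!map_comp; congr (_ :: _); apply: eq_map.
Qed.

Lemma bdry_map (T U : Type) (f : T -> U) c :
  bdry (map (map f) c) = map (map f) (bdry c).
Proof.
by rewrite /bdry map_flatten -!map_comp; congr flatten;
  apply: eq_map => s; exact: facets_map.
Qed.

Lemma size_facets (T : eqType) (s t : seq T) :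
  t \in facets s -> size t = (size s).-1.
Proof.
elim: s t => //= x s IH t; rewrite inE => /predU1P[->//|/mapP[u us ->/=]].
by rewrite (IH _ us) prednK//; case: s us {IH}.
Qed.

Lemma subseq_facets (T : eqType) (s t : seq T) : t \in facets s -> subseq t s.
Proof.
elim: s t => //= x s IH t; rewrite inE => /predU1P[->|/mapP[u us ->/=]].
  exact: subseq_cons.
by rewrite eqxx IH.
Qed.

(** * Barycentric subdivision of chains *)

Section subdivision.
Variables (T : eqType) (b : seq T -> T).

(* [sd d] is meant for simplices with [d] vertices. *)
Fixpoint sd (d : nat) (s : seq T) : seq (seq T) :=
  if d is d'.+1 then map (cons (b s)) (flatten (map (sd d') (facets s)))
  else [:: [::]].

Lemma size_sd d s t : t \in sd d s -> size t = d.
Proof.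
elim: d s t => [|d IH] s t /=; first by rewrite inE => /eqP->.
by move=> /mapP[u /flatten_mapP[v _ /IH <-] ->].
Qed.

(** Subdivision is a chain map. The cone formula leaves the subdivided facets plus a cone over their
    boundary, which by induction is the subdivision of a double boundary and vanishes. *)
Lemma parity_bdry_sd F d s : size s = d ->
  parity F (bdry (sd d s)) = parity F (flatten (map (sd d.-1) (facets s))).
Proof.
elim: d s F => [|d IH] s F; first by case: s => // _; rewrite /= /parity !big_nil.
move=> ss; rewrite [sd _ _]/= parity_bdry_cone -[d.+1.-1]/d.
rewrite [X in _ (+) X](_ : _ = false) ?addbF// parity_bdry parity_flatten.
rewrite (@eq_in_parity _ _ (fun t => parity (fun u => parity (F \o cons (b s))
  (sd d.-1 u)) (facets t))); last first.
  move=> t tf; rewrite -parity_bdry IH ?parity_flatten//.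
  by rewrite (size_facets tf) ss.
by rewrite -parity_bdry bdry_bdry.
Qed.

Lemma sd_map (f : T -> T) d s : (forall s, b (map f s) = f (b s)) ->
  sd d (map f s) = map (map f) (sd d s).
Proof.
move=> bf; elim: d s => //= d IH s; rewrite bf facets_map -!map_comp.
rewrite (eq_map (g := map (map f) \o sd d)); last by move=> t /=; rewrite IH.
by rewrite map_comp -map_flatten -!map_comp.
Qed.

Lemma sd_vertices (P : T -> Prop) d s :
  (forall t, t != [::] -> {in t, forall v, P v} -> P (b t)) ->
  {in s, forall v, P v} -> size s = d ->
  {in sd d s, forall t, {in t, forall v, P v}}.
Proof.
move=> Pb; elim: d s => [|d IH] s Ps ss t /=; first by rewrite inE => /eqP->.
move=> /mapP[u /flatten_mapP[w wf uw ->] v]; rewrite inE => /predU1P[->|vu].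
  by apply: Pb => //; case: s ss {Ps wf}.
apply: (IH w _ _ u) => // [x xw|].
  by apply: Ps; exact: (mem_subseq (subseq_facets wf)).
by rewrite (size_facets wf) ss.
Qed.

End subdivision.

(** * Antipodal hemispheres and the octahedral triangulation *)

Section hemispheres.
Variables (T : eqType) (nu : T -> T).

(** [H j] models the upper half of a triangulated [j]-sphere: mod 2, its boundary is the sphere one
    dimension lower, made of the previous hemisphere and its antipode. *)
Definition antipodal_hemispheres (H : nat -> seq (seq T)) :=
  [/\ exists v, H 0 = [:: [:: v]],
      forall j, {in H j, forall s, size s = j.+1} &
      forall j F, parity F (bdry (H j.+1)) =
                  parity F (H j ++ map (map nu) (H j))].

Lemma antipodal_hemispheres_sd (b : seq T -> T) H :
  (forall s, b (map nu s) = nu (b s)) ->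
  antipodal_hemispheres H ->
  antipodal_hemispheres (fun j => flatten (map (sd b j.+1) (H j))).
Proof.
move=> bnu [[v H0] sH dH]; split.
- by exists (b [:: v]); rewrite H0.
- by move=> j s /flatten_mapP[t _ /size_sd].
- move=> j F; rewrite parity_bdry parity_flatten.
  rewrite (@eq_in_parity _ _ (fun s => parity (fun t => parity F (sd b j.+1 t))
     (facets s))); last first.
    by move=> s /sH ss; rewrite -parity_bdry parity_bdry_sd// parity_flatten.
  rewrite -parity_bdry dH !parity_cat parity_flatten; congr addb.
  rewrite map_flatten -!map_comp parity_flatten parity_map.
  apply: eq_parity => s.
  exact: (congr1 (parity F) (sd_map j.+1 s bnu)).
Qed.

Section octahedron.
Variable (e : nat -> T).

(** The cone with apex [e j] over the whole octahedral sphere one dimension lower. *)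
Fixpoint octahedral_hemisphere (j : nat) : seq (seq T) :=
  if j is j'.+1 then
    map (cons (e j)) (octahedral_hemisphere j' ++
                      map (map nu) (octahedral_hemisphere j'))
  else [:: [:: e 0]].

(** The base of each cone has no boundary: its two hemispheres are bounded by the same antipodally
    invariant sphere (by the empty simplex in dimension 0), which cancels mod 2. *)
Lemma octahedral_hemisphereP : involutive nu ->
  antipodal_hemispheres octahedral_hemisphere.
Proof.
move=> nuK; split; first by exists (e 0).
  elim=> [|j IH] s /=; first by rewrite inE => /eqP->.
  move=> /mapP[t + ->/=]; rewrite mem_cat => /orP[/IH->//|/mapP[u /IH su ->]].
  by rewrite size_map su.
pose S j := octahedral_hemisphere j ++ map (map nu) (octahedral_hemisphere j).
have HS j : octahedral_hemisphere j.+1 = map (cons (e j.+1)) (S j) by [].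
move=> j F; rewrite -/(S j); elim: j F => [|j IH] F;
  rewrite HS parity_bdry_cone;
  rewrite [X in _ (+) X](_ : _ = false) ?addbF//;
  rewrite /S bdry_cat parity_cat bdry_map parity_map.
  by rewrite addbb.
rewrite !IH !parity_cat !parity_map.
set G := F \o _; rewrite (@eq_parity _ (G \o map nu \o map nu) G).
  by do 2 case: (parity _ _).
by move=> s; rewrite /= -map_comp map_id_in// => v _ /=; rewrite nuK.
Qed.

End octahedron.
End hemispheres.

(** * Signed labels and alternating simplices *)

Section Fan.

(* A label [x] encodes a signed index: the index is [x./2], the sign [odd x];
   [flip] changes the sign. *)
Definition flip (x : nat) : nat := if odd x then x.-1 else x.+1.

Lemma odd_flip x : odd (flip x) = ~~ odd x.
Proof. by rewrite /flip; case: x => //= x; case ox: (odd x) => /=; rewrite ?ox. Qed.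

Lemma half_flip x : (flip x)./2 = x./2.
Proof.
rewrite /flip; case: ifP => ox; last by rewrite /= uphalf_half ox.
by case: x ox => //= x; rewrite uphalf_half => /negbTE->.
Qed.

Lemma half_odd_inj x y : x./2 = y./2 -> odd x = odd y -> x = y.
Proof. by move=> h o; rewrite -(odd_double_half x) -(odd_double_half y) h o. Qed.

(** Absence of a complementary edge, the hypothesis in the lemmas of Tucker and Fan. *)
Definition noncomplementary (l : seq nat) : Prop :=
  {in l &, forall x y, x./2 = y./2 -> x = y}.

Fixpoint alternating (eps : bool) (l : seq nat) : bool :=
  if l is x :: t then
    [&& odd x == eps, (if t is y :: _ then x./2 < y./2 else true)
      & alternating (~~ eps) t]
  else true.

(** Codes grow with the index, so sorting them lists the indices in increasing order; the test
    depends only on the multiset of labels. *)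
Definition sort_alternating eps (l : seq nat) := alternating eps (sort leq l).

Lemma alternating_flip eps l :
  alternating eps (map flip l) = alternating (~~ eps) l.
Proof.
elim: l eps => //= x l IH eps; rewrite IH odd_flip; congr [&& _, _ & _].
  by case: (odd x) eps => -[].
by case: l {IH} => //= y l; rewrite !half_flip.
Qed.

Lemma noncomplementary_sub (l l' : seq nat) :
  {subset l' <= l} -> noncomplementary l -> noncomplementary l'.
Proof. by move=> ll nl x y /ll xl /ll; exact: nl. Qed.

(** Different indices decide the order whatever the signs; only a complementary pair would be
    reversed. *)
Lemma leq_flip x y : x <= y -> (x./2 = y./2 -> x = y) -> flip x <= flip y.
Proof.
move=> xy xyE; have := half_leq xy; rewrite leq_eqVlt => /predU1P[/xyE->//|h].
have := odd_double_half (flip x); have := odd_double_half (flip y).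
rewrite !half_flip => <- <-; case: (odd _); case: (odd _) => /=;
  by rewrite ?add0n ?add1n ?ltnS ?leq_double ?(ltnW h)// ?leqW// ?ltn_double ?leq_double// ltnW.
Qed.

Lemma sort_alternating_flip eps l : noncomplementary l ->
  sort_alternating eps (map flip l) = sort_alternating (~~ eps) l.
Proof.
move=> nl; rewrite /sort_alternating -alternating_flip; congr alternating.
apply: (sorted_eq leq_trans anti_leq).
- by apply: sort_sorted; exact: leq_total.
- rewrite sorted_map; apply: (@sub_in_sorted _ (mem l) leq).
  + move=> x y xl yl xy; apply: leq_flip => //; exact: nl.
  + by apply/allP => x; rewrite mem_sort.
  + by apply: sort_sorted; exact: leq_total.
- by rewrite perm_sort perm_map// perm_sym perm_sort.
Qed.

(** Induction on the smallest label. If it occurs twice, only the two facets that drop one copy can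
    alternate, and these are equal and cancel. Otherwise a facet keeping [x] alternates exactly when
    the sign of [x] fits and the rest alternates with the opposite leading sign. *)
Lemma parity_facets_sorted eps l : sorted leq l -> noncomplementary l ->
  parity (alternating eps) (facets l) = alternating true l (+) alternating false l.
Proof.
elim: l eps => [|x [|y l] IH] eps; first by rewrite /parity big_nil.
  by rewrite /= parity_cons /parity big_nil /=; case: (odd x).
move=> /[dup] /andP[xy yl] xyl nl; rewrite parity_facets_cons.
have nl' : noncomplementary (y :: l).
  by apply: noncomplementary_sub nl => z; rewrite [in X in _ -> X]inE => ->; rewrite orbT.
have /predU1P[xyE|xyh] : (x == y) || (x./2 < y./2).
  have := half_leq xy; rewrite leq_eqVlt => /predU1P[h|->]; last by rewrite orbT.
  by rewrite (nl x y) ?eqxx ?inE ?eqxx ?orbT.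
  have xx e' t : alternating e' [:: x, x & t] = false by rewrite /= ltnn andbF.
  rewrite -xyE !xx [facets _]/= parity_cons parity_map.
  by rewrite /parity big1 ?addbF => [|s _]; [exact: addbb|exact: xx].
rewrite (@eq_in_parity _ _ (fun t => (odd x == eps) && alternating (~~ eps) t)).
  have -> : parity (fun t => (odd x == eps) && alternating (~~ eps) t)
       (facets (y :: l)) = (odd x == eps) && parity (alternating (~~ eps)) (facets (y :: l)).
    rewrite /parity; case: (odd x == eps) => //=; by rewrite big1.
  have xA e : alternating e [:: x, y & l] = (odd x == e) && alternating (~~ e) (y :: l).
    by rewrite [LHS]/= xyh.
  rewrite (IH (~~ eps))// !xA /negb; case: eps;
    move: (alternating true (y :: l)) (alternating false (y :: l)) => [] [];
    by case: (odd x).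
move=> t tf; rewrite [LHS]/=; case: t tf => // z t zt.
suff -> : x./2 < z./2 by [].
apply: (leq_trans xyh); apply: half_leq.
have : z \in y :: l by apply: (mem_subseq (subseq_facets zt)); rewrite mem_head.
rewrite inE => /predU1P[->//|zl].
by have /allP/(_ _ zl) := order_path_min leq_trans yl.
Qed.

(** Deleting one of several equal entries gives the same list only up to order, whence the
    invariance asked of [F]. As a sum over deleted entries, the count is visibly independent of the
    order of [l]. *)
Lemma parity_facets_rem (T : eqType) (F : seq T -> bool) l :
  (forall s t, perm_eq s t -> F s = F t) ->
  parity F (facets l) = \big[addb/false]_(x <- l) F (rem x l).
Proof.
elim: l F => [|x l IH] F Fp; first by rewrite /parity !big_nil.
rewrite parity_facets_cons IH; last by move=> s t st; apply: Fp; rewrite perm_cons.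
rewrite big_cons /= eqxx; congr addb; apply: eq_big_seq => y yl /=.
by case: eqVneq => // <- in yl *; apply: Fp; rewrite perm_sym perm_to_rem.
Qed.

Lemma parity_facets_perm (T : eqType) (F : seq T -> bool) l l' :
  (forall s t, perm_eq s t -> F s = F t) -> perm_eq l l' ->
  parity F (facets l) = parity F (facets l').
Proof.
move=> Fp ll'; rewrite !parity_facets_rem// (perm_big _ ll').
apply: eq_big_seq => x xl'; apply: Fp.
have xl : x \in l by rewrite (perm_mem ll').
by rewrite -(perm_cons x) -(permPl (perm_to_rem xl)) -(permPr (perm_to_rem xl')).
Qed.

Lemma sort_alternating_perm eps s t :
  perm_eq s t -> sort_alternating eps s = sort_alternating eps t.
Proof.
by move=> /(perm_sortP leq_total leq_trans anti_leq) st; rewrite /sort_alternating st.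
Qed.

Lemma parity_facets_alternating eps l : noncomplementary l ->
  parity (sort_alternating eps) (facets l) =
  sort_alternating true l (+) sort_alternating false l.
Proof.
move=> nl; rewrite /sort_alternating -(parity_facets_sorted eps); first last.
- by apply: noncomplementary_sub nl => x; rewrite mem_sort.
- by apply: sort_sorted; exact: leq_total.
rewrite (@parity_facets_perm _ _ l (sort leq l)); first last.
- by rewrite perm_sym perm_sort.
- by move=> s t; exact: sort_alternating_perm.
apply: eq_in_parity => s /subseq_facets sl.
rewrite (sorted_sort leq_trans)//.
by apply: (subseq_sorted leq_trans sl); apply: sort_sorted; exact: leq_total.
Qed.

Lemma alternating_sorted eps l : alternating eps l -> sorted ltn (map half l).
Proof.
elim: l eps => // x [|y l] IH eps //= /and3P[_ xy yl].
by rewrite xy; exact: IH yl.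
Qed.

Lemma sort_alternating_size eps l m : sort_alternating eps l ->
  {in l, forall x, x./2 < m} -> size l <= m.
Proof.
move=> /alternating_sorted/(sorted_uniq ltn_trans ltnn) ul lm.
rewrite -[m](size_iota 0) -(size_sort leq) -(size_map half).
apply: uniq_leq_size ul _ => _ /mapP[x + ->]; rewrite mem_sort mem_iota => xl.
exact: lm.
Qed.

(* Ky Fan's counting argument: an alternating simplex has two alternating
   facets, one for each leading sign, so the number of alternating
   simplices of a hemisphere has the same parity in every dimension. *)
Lemma Fan_parity (T : eqType) (nu : T -> T) (lab : T -> nat)
    (H : nat -> seq (seq T)) d :
  antipodal_hemispheres nu H ->
  (forall j, j <= d -> {in H j, forall s, {in s, forall v, lab (nu v) = flip (lab v)}}) ->
  (forall j, j <= d -> {in H j, forall s, noncomplementary (map lab s)}) ->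
  parity (fun s => sort_alternating true (map lab s) (+)
                   sort_alternating false (map lab s)) (H d).
Proof.
move=> [[v H0] _ dH]; elim: d => [|d IH] labnu labnc.
  by rewrite H0 /parity big_seq1 /sort_alternating /=; case: (odd _).
rewrite (@eq_in_parity _ _ (fun s =>
    parity (sort_alternating true \o map lab) (facets s))); last first.
  move=> s sH; rewrite /= -(parity_facets_alternating true).
    by rewrite facets_map parity_map.
  exact: (labnc d.+1).
rewrite -parity_bdry dH parity_cat parity_map.
(* On the antipodal copy all labels are flipped, so counting leading sign [true] there is counting
   [false] on [H d]. The two copies together give the count of the induction hypothesis. *)
rewrite (@eq_in_parity _ (_ \o map nu) (sort_alternating false \o map lab)).
  rewrite -parityD; apply: IH => j jd; [apply: labnu|apply: labnc]; exact: leqW.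
move=> s sH /=; rewrite -[false]/(~~ true) -sort_alternating_flip; last first.
  exact: (labnc d).
congr sort_alternating; rewrite -!map_comp.
by apply/eq_in_map => x xs /=; rewrite (labnu d _ s).
Qed.

(** An odd number of alternating simplices is not zero, and one of them has [d + 1] pairwise
    distinct indices below [m]. *)
Lemma Fan (T : eqType) (nu : T -> T) (lab : T -> nat)
    (H : nat -> seq (seq T)) d m :
  antipodal_hemispheres nu H ->
  (forall j, j <= d -> {in H j, forall s, {in s, forall v, lab (nu v) = flip (lab v)}}) ->
  (forall j, j <= d -> {in H j, forall s, noncomplementary (map lab s)}) ->
  (forall s, s \in H d -> {in s, forall v, (lab v)./2 < m}) ->
  d < m.
Proof.
move=> hH labnu labnc labm.
have /parity_exists[s sH sa] := Fan_parity hH labnu labnc.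
have [_ /(_ d s sH) <- _] := hH; rewrite -(size_map lab).
have sl : {in map lab s, forall x, x./2 < m}.
  by move=> _ /mapP[v vs ->]; exact: labm sH _ vs.
by case: (boolP (sort_alternating true _)) sa => [a _|_ a]; exact: sort_alternating_size a sl.
Qed.

End Fan.

Local Open Scope ring_scope.

(** * Subdivided hemispheres *)

Section barycenter.
Variables (R : realType) (V : normedModType R).
Implicit Types (s t : seq V) (x c : V).

Definition barycenter s : V := (size s)%:R^-1 *: \sum_(v <- s) v.

Lemma barycenterN s : barycenter (map -%R s) = - barycenter s.
Proof. by rewrite /barycenter size_map big_map sumrN scalerN. Qed.

Lemma sub_barycenter c s : s != [::] ->
  c - barycenter s = (size s)%:R^-1 *: \sum_(v <- s) (c - v).
Proof.
move=> s0; rewrite sumrB big_const_seq count_predT iter_addr_0 scalerBr.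
by rewrite -(scaler_nat _ c) scalerA mulVf ?scale1r// pnatr_eq0 size_eq0.
Qed.

Lemma ler_norm_sum_seq s (f : V -> V) (r : R) : {in s, forall v, `|f v| <= r} ->
  `|\sum_(v <- s) f v| <= (size s)%:R * r.
Proof.
move=> fr; apply: (le_trans (ler_norm_sum _ _ _)).
rewrite big_seq (le_trans (ler_sum _ fr))// -big_seq.
by rewrite big_const_seq count_predT iter_addr_0 mulr_natl.
Qed.

Lemma barycenter_dist c r s : s != [::] -> {in s, forall v, `|c - v| <= r} ->
  `|c - barycenter s| <= r.
Proof.
move=> s0 sr; have k0 : 0 < (size s)%:R :> R by rewrite ltr0n lt0n size_eq0.
rewrite sub_barycenter// normrZ ger0_norm ?invr_ge0 ?(ltW k0)//.
by rewrite ler_pdivrMl// ler_norm_sum_seq.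
Qed.

(** The barycenter averages over all vertices, and [x] itself contributes distance 0: only
    [size s - 1] terms of the mean remain. *)
Lemma barycenter_dist_vertex x s (D : R) : x \in s -> {in s, forall v, `|x - v| <= D} ->
  `|x - barycenter s| <= (1 - (size s)%:R^-1) * D.
Proof.
move=> xs sD; have s0 : s != [::] by case: s xs {sD}.
have k0 : 0 < (size s)%:R :> R by rewrite ltr0n lt0n size_eq0.
rewrite sub_barycenter// normrZ ger0_norm ?invr_ge0 ?(ltW k0)//.
rewrite ler_pdivrMl//.
have -> : \sum_(v <- s) (x - v) = \sum_(v <- rem x s) (x - v).
  by rewrite (perm_big _ (perm_to_rem xs)) big_cons /= subrr add0r.
rewrite (@le_trans _ _ ((size (rem x s))%:R * D))//.
  by apply: ler_norm_sum_seq => v /mem_rem; exact: sD.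
rewrite size_rem// mulrA mulrBr mulr1 divff ?gt_eqF// -subn1 natrB//.
by case: s xs {sD s0 k0}.
Qed.

(** Two vertices of a subdivided simplex either both come from a facet, where induction applies, or
    one is the barycenter. [N] bounds the number of vertices in every dimension, so one contraction
    factor serves all hemispheres. *)
Lemma sd_mesh (N d : nat) s (D : R) : size s = d -> (d <= N)%N ->
  {in s &, forall u v, `|u - v| <= D} ->
  {in sd barycenter d s, forall t,
    {in t &, forall u v, `|u - v| <= (1 - N%:R^-1) * D}}.
Proof.
elim: d s => [|d IH] s ss dN sD t /=; first by rewrite inE => /eqP->.
have N0 : (0 < N)%N by exact: leq_ltn_trans dN.
have N1 : N%:R^-1 <= 1 :> R by rewrite invf_le1 ?ltr0n// ler1n.
have D0 : 0 <= D.
  case: s ss sD => // x s _ /(_ x x); rewrite subrr normr0; apply; exact: mem_head.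
have sk : (1 - (size s)%:R^-1) * D <= (1 - N%:R^-1) * D.
  apply: ler_wpM2r => //; rewrite lerD2l lerN2 lef_pV2 ?posrE ?ltr0n ?ss//.
  by rewrite ler_nat.
move=> /mapP[u /flatten_mapP[w wf uw ->]].
have sw : size w = d by rewrite (size_facets wf) ss.
have wss : {subset w <= s} by exact: (mem_subseq (subseq_facets wf)).
(* The ball around the barycenter contains the vertices of [w] and is stable under barycenters, so
   it contains all vertices of the subdivision of [w]. *)
have bu : {in u, forall v, `|barycenter s - v| <= (1 - N%:R^-1) * D}.
  apply: (@sd_vertices _ barycenter
    (fun v => `|barycenter s - v| <= (1 - N%:R^-1) * D) d w) => //.
    by move=> t' t'0 tr; exact: barycenter_dist.
  move=> v /wss vs; apply: le_trans sk; rewrite distrC.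
  by apply: barycenter_dist_vertex => // y ys; exact: sD.
move=> x y; rewrite !inE => /predU1P[->|xu] /predU1P[->|yu].
- by rewrite subrr normr0 mulr_ge0// subr_ge0.
- exact: bu.
- by rewrite distrC; exact: bu.
- apply: (IH w _ _ _ u) => //; first exact: ltnW.
  by move=> a b /wss ? /wss ?; exact: sD.
Qed.

End barycenter.

Section small_hemispheres.
Variables (R : realType) (n : nat).
Implicit Types (v : 'rV[R]_n) (s : seq 'rV[R]_n).

(* the face of the cross-polytope in the orthant with signs [eps] *)
Definition orthant_face (eps : 'I_n -> R) v : Prop :=
  (forall i, 0 <= eps i * v ord0 i) /\ \sum_i eps i * v ord0 i = 1.

Definition in_orthant_face s : Prop :=
  exists2 eps : 'I_n -> R, (forall i, `|eps i| = 1) & {in s, forall v, orthant_face eps v}.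

Lemma orthant_face_norm1 eps v : (forall i, `|eps i| = 1) -> orthant_face eps v ->
  \sum_i `|v ord0 i| = 1.
Proof.
move=> e1 [ev <-]; apply: eq_bigr => i _.
by rewrite -[RHS]ger0_norm ?ev// normrM e1 mul1r.
Qed.

Lemma orthant_face_barycenter eps s : s != [::] ->
  {in s, forall v, orthant_face eps v} -> orthant_face eps (barycenter s).
Proof.
move=> s0 sP; have k0 : 0 < (size s)%:R :> R by rewrite ltr0n lt0n size_eq0.
have bE i : eps i * barycenter s ord0 i =
    (size s)%:R^-1 * \sum_(v <- s) eps i * v ord0 i.
  by rewrite !mxE summxE mulrCA big_distrr.
split=> [i|].
  rewrite bE mulr_ge0 ?invr_ge0 ?(ltW k0)// big_seq sumr_ge0// => v /sP[].
  exact.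
under eq_bigr do rewrite bE.
rewrite -big_distrr /= exchange_big /= big_seq.
rewrite (eq_bigr (fun=> 1)); last by move=> v /sP[].
by rewrite -big_seq big_const_seq count_predT iter_addr_0 mulVf ?gt_eqF.
Qed.

(** Indexed by all naturals to serve as the sequence of apexes; it is the zero vector for [j >= n],
    so geometric claims are restricted to [j < n]. *)
Definition basis_vec (j : nat) : 'rV[R]_n := \row_i (i == j :> nat)%:R.

Lemma octahedral_in_orthant_face j : (j < n)%N ->
  {in octahedral_hemisphere -%R basis_vec j, forall s, in_orthant_face s}.
Proof.
(* The induction also records that vertices vanish beyond coordinate [j]. The sign at the new
   coordinate is then free and can be set to 1 for the new apex. *)
move=> jn; suff H : {in octahedral_hemisphere -%R basis_vec j, forall s,
   exists2 eps : 'I_n -> R, (forall i, `|eps i| = 1) &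
     {in s, forall v, orthant_face eps v /\ forall i : 'I_n, (j < i)%N -> v ord0 i = 0}}.
  by move=> s /H[eps e1 es]; exists eps => // v /es[].
elim: j jn => [|j IH] jn s /=.
  rewrite inE => /eqP->; exists (fun=> 1) => [i|v]; first exact: normr1.
  rewrite inE => /eqP->; split; last by move=> i; rewrite mxE; case: (nat_of_ord i).
  split=> [i|]; first by rewrite mul1r mxE.
  rewrite (bigD1 (Ordinal jn))//= big1; first by rewrite mxE eqxx mul1r addr0.
  by move=> i /negPf; rewrite -val_eqE /= mxE => ->; rewrite mulr0.
have {}IH : {in octahedral_hemisphere -%R basis_vec j ++
      map (map -%R) (octahedral_hemisphere -%R basis_vec j), forall s,
   exists2 eps : 'I_n -> R, (forall i, `|eps i| = 1) &
     {in s, forall v, orthant_face eps v /\ forall i : 'I_n, (j < i)%N -> v ord0 i = 0}}.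
  move=> t; rewrite mem_cat => /orP[/(IH (ltnW jn))//|/mapP[u /(IH (ltnW jn))[eps e1 ue] ->]].
  exists (fun i => - eps i) => [i|_ /mapP[v /ue[[v0 v1] vj] ->]]; first by rewrite normrN.
  split; last by move=> i /vj; rewrite mxE => ->; rewrite oppr0.
  split=> [i|]; first by rewrite mxE mulrNN.
  by rewrite -v1; apply: eq_bigr => i _; rewrite mxE mulrNN.
move=> /mapP[t /IH[eps e1 te] ->].
exists (fun i => if i == Ordinal jn then 1 else eps i) => [i|v].
  by case: ifP => _; rewrite ?normr1.
rewrite inE => /predU1P[->|/te[[v0 v1] vj]]; last first.
  split; last by move=> i /ltnW; exact: vj.
  split=> [i|].
    by case: ifP => [/eqP->|_] //; rewrite vj//= mulr0.
  rewrite -v1; apply: eq_bigr => i _; case: ifP => [/eqP->|//].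
  by rewrite vj//= !mulr0.
split; last by move=> i ji; rewrite mxE gtn_eqF.
split=> [i|]; first by rewrite mxE -val_eqE/=; case: eqP => _; rewrite ?mulr0 ?mulr1 ?ler01.
rewrite (bigD1 (Ordinal jn))//= big1; first by rewrite eqxx mxE eqxx mulr1 addr0.
by move=> i /negPf; rewrite -val_eqE /= mxE => ->; rewrite mulr0.
Qed.

Lemma orthant_face_dist eps u v : (forall i, `|eps i| = 1) ->
  orthant_face eps u -> orthant_face eps v -> `|u - v| <= 1.
Proof.
move=> e1 [u0 u1] [v0 v1].
have coord01 (x : 'rV[R]_n) i : (forall i, 0 <= eps i * x ord0 i) ->
    \sum_i eps i * x ord0 i = 1 -> eps i * x ord0 i <= 1.
  by move=> x0 <-; rewrite (bigD1 i)//= lerDl sumr_ge0.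
rewrite /Num.norm /= mx_normrE; apply/bigmax_leP; split => //= -[k i] _ /=.
rewrite (ord1 k) !mxE -[leLHS]mul1r -(e1 i) -normrM mulrBr ler_norml.
have := coord01 u i u0 u1; have := coord01 v i v0 v1.
have := u0 i; have := v0 i.
move: (eps i * u ord0 i) (eps i * v ord0 i) => a b b0 a0 b1 a1.
rewrite e1; apply/andP; split; lra.
Qed.

(** Each barycentric subdivision of the octahedral hemispheres shrinks the diameters by the factor
    [q], starting from 1. *)
Lemma small_hemispheres (e : R) : 0 < e ->
  exists H, [/\ antipodal_hemispheres -%R H,
    forall j, (j < n)%N -> {in H j, forall s, in_orthant_face s} &
    forall j, (j < n)%N -> {in H j, forall s, {in s &, forall u v, `|u - v| < e}}].
Proof.
move=> e0; pose q : R := 1 - n%:R^-1.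
(* For [n = 0] the inverse is 0 and [q] is 1, but no dimension [j < n] is left to check. *)
have [n0|n0] := posnP n.
  exists (octahedral_hemisphere -%R basis_vec); split.
  - by apply: octahedral_hemisphereP; exact: opprK.
  - by move=> j jn; exfalso; move: jn; rewrite n0.
  - by move=> j jn; exfalso; move: jn; rewrite n0.
have q0 : 0 <= q by rewrite subr_ge0 invf_le1 ?ltr0n// ler1n.
have q1 : q < 1 by rewrite /q ltrBlDr ltrDl invr_gt0 ltr0n.
have [k ke] : exists k, q ^+ k < e.
  have /cvgrPdist_lt/(_ _ e0) : q ^+ k @[k --> \oo] --> 0 by apply: cvg_expr; rewrite ger0_norm.
  case=> k _ /(_ k (leqnn k)); rewrite sub0r normrN ger0_norm ?exprn_ge0// => ?.
  by exists k.
suff [H [H1 H2 H3]] : exists H, [/\ antipodal_hemispheres -%R H,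
    forall j, (j < n)%N -> {in H j, forall s, in_orthant_face s} &
    forall j, (j < n)%N -> {in H j, forall s, {in s &, forall u v, `|u - v| <= q ^+ k}}].
  exists H; split=> // j jn s sH u v us vs.
  exact: le_lt_trans (H3 j jn s sH u v us vs) ke.
elim: k {ke} => [|k [H [H1 H2 H3]]].
  exists (octahedral_hemisphere -%R basis_vec); split=> [|j|j jn].
  - by apply: octahedral_hemisphereP; exact: opprK.
  - exact: octahedral_in_orthant_face.
  - move=> s /(octahedral_in_orthant_face jn)[eps e1 se] u v us vs.
    by rewrite expr0; apply: (orthant_face_dist e1); exact: se.
exists (fun j => flatten (map (sd (@barycenter R _) j.+1) (H j))); split.
- by apply: antipodal_hemispheres_sd H1; exact: barycenterN.
- move=> j jn t /flatten_mapP[s sH ts].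
  have [eps e1 se] := H2 j jn s sH; exists eps => //.
  apply: (@sd_vertices _ (@barycenter R _) _ j.+1 s) ts => //.
    by move=> t'; exact: orthant_face_barycenter.
  by have [_ /(_ j s sH)] := H1.
- move=> j jn t /flatten_mapP[s sH ts]; rewrite exprS.
  apply: (sd_mesh (s := s) _ jn _ ts); last exact: H3 sH.
  by have [_ /(_ j s sH)] := H1.
Qed.

End small_hemispheres.

(** * The Borsuk-Ulam theorem *)

Lemma cvg_row (R : realType) (T : Type) (F : set_system T) (FF : Filter F) m
    (f : T -> 'rV[R]_m) (l : 'rV[R]_m) :
  (forall j, f y ord0 j @[y --> F] --> l ord0 j) -> f y @[y --> F] --> l.
Proof.
move=> fl; apply/cvg_ballP => e e0.
have : \forall y \near F, forall j, ball (l ord0 j) e (f y ord0 j).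
  by apply: filter_forall => j; have /cvg_ballP/(_ e e0) := fl j.
by apply: filterS => y fy; split=> // i j; rewrite (ord1 i).
Qed.

Lemma continuous_row (R : realType) (T : topologicalType) m (f : T -> 'rV[R]_m) (x : T) :
  (forall j, {for x, continuous (fun y => f y ord0 j)}) -> {for x, continuous f}.
Proof. exact: cvg_row. Qed.

Lemma continuous_sum (R : realType) (T : topologicalType) (I : Type) (r : seq I)
    (P : pred I) (f : I -> T -> R) (x : T) :
  (forall i, P i -> {for x, continuous (f i)}) ->
  {for x, continuous (fun y => \sum_(i <- r | P i) f i y)}.
Proof. by move=> fx; apply: cvg_big => //; exact: add_continuous. Qed.

Lemma continuous_coord_norm (R : realType) n (i : 'I_n) :
  continuous (fun x : 'rV[R]_n => `|x ord0 i|).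
Proof.
by move=> x; apply: continuous_comp; [exact: coord_continuous|exact: norm_continuous].
Qed.

Lemma norm_coord_le (R : realType) n (x : 'rV[R]_n) (i : 'I_n) : `|x ord0 i| <= `|x|.
Proof.
by rewrite [leRHS]/Num.norm /= mx_normrE; apply/bigmax_geP; right => /=; exists (ord0, i).
Qed.

Lemma norm_rV_le (R : realType) n (x : 'rV[R]_n) (M : R) : 0 <= M ->
  (forall i, `|x ord0 i| <= M) -> `|x| <= M.
Proof.
move=> M0 xM; rewrite /Num.norm /= mx_normrE; apply/bigmax_leP; split => //= -[k i] _ /=.
by rewrite (ord1 k).
Qed.

Lemma norm_rV_attained (R : realType) n (x : 'rV[R]_n) : (0 < n)%N ->
  exists i, `|x ord0 i| = `|x|.
Proof.
case: n x => // n x _; have [x0|x0] := eqVneq `|x| 0.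
  by exists ord0; apply/eqP; rewrite eq_le norm_coord_le x0 normr_ge0.
have [[k i] /= xk] := mx_norm_neq0 x0; exists i.
by move: xk; rewrite (ord1 k) => xk; exact: (esym xk).
Qed.

(** Tietze's theorem extends each coordinate, which is bounded on the compact [B]. The odd part of
    the extension still agrees with [h] on the symmetric set [B]. *)
Lemma odd_extension (R : realType) n m (B : set 'rV[R]_n) (h : 'rV[R]_n -> 'rV[R]_m) :
  compact B -> closed B -> symmetric_set B -> {within B, continuous h} ->
  (forall x, B x -> h (- x) = - h x) ->
  exists H : 'rV[R]_n -> 'rV[R]_m,
    [/\ continuous H, (forall x, H (- x) = - H x) & (forall x, B x -> H x = h x)].
Proof.
move=> cB clB sB ch oh.
have /choice[g gP] (j : 'I_m) : exists g : 'rV[R]_n -> R,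
    continuous g /\ forall x, B x -> g x = h x ord0 j.
  have cj : {within B, continuous (fun x => h x ord0 j : R^o)}.
    move=> x; apply: (@continuous_comp (subspace B) _ _ (h : subspace B -> _)
      (fun v : 'rV[R]_m => v ord0 j : R^o)).
      exact: ch.
    exact: coord_continuous.
  have /ex_strict_bound_gt0[k k0 /= hk] :
      bounded_set ((fun x => h x ord0 j : R^o) @` B).
    exact/compact_bounded/continuous_compact.
  have bk : forall x, B x -> `|h x ord0 j| <= k.
    by move=> x Bx; apply/ltW/hk; exists x.
  have [g [hg cg _]] := continuous_bounded_extension (@pseudometric_normal R _) clB k0 cj bk.
  by exists g; split=> // x Bx; rewrite hg ?inE.
have cN : continuous (-%R : 'rV[R]_n -> 'rV[R]_n) by exact: opp_continuous.
exists (fun x => \row_j (2^-1 * (g j x - g j (- x)))); split.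
- move=> x; apply: continuous_row => j.
  rewrite (_ : (fun y => _) = fun y => 2^-1 * (g j y - g j (- y))); last first.
    by apply/funext => y; rewrite mxE.
  apply: continuousM; first exact: cst_continuous.
  apply: continuousB; first exact: (gP j).1.
  by apply: continuous_comp; [exact: cN|exact: (gP j).1].
- by move=> x; apply/rowP => j; rewrite !mxE opprK -mulrN opprB.
- move=> x Bx; apply/rowP => j; rewrite mxE !(gP j).2//; last exact: sB.
  by rewrite oh// mxE; field.
Qed.

Section Borsuk_Ulam.
Variables (R : realType) (n : nat).

Definition cross_polytope : set 'rV[R]_n := [set x | \sum_i `|x ord0 i| = 1].

Lemma cross_polytope_compact : compact cross_polytope.
Proof.
apply: bounded_closed_compact.
  exists 1; split; first exact: num_real.
  move=> M M1 x /= x1; apply: norm_rV_le => [|i].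
    by apply: ltW; exact: lt_trans M1.
  by apply: (le_trans _ (ltW M1)); rewrite -x1 (bigD1 i)//= lerDl sumr_ge0.
have c : continuous (fun x : 'rV[R]_n => \sum_i `|x ord0 i|).
  by move=> x; apply: continuous_sum => i _; exact: continuous_coord_norm.
exact: ((continuous_closedP _).1 c _ (@closed_eq R 1)).
Qed.

Lemma cross_polytope_neq0 x : cross_polytope x -> x != 0.
Proof.
apply: contraPneq => -> /=; rewrite /cross_polytope /= big1; last first.
  by move=> i _; rewrite mxE normr0.
by move/esym/eqP; rewrite oner_eq0.
Qed.

(** The point [y] may leave [X]. Compactness is used in the form: what holds near each point of [X]
    for all small [d > 0] holds on all of [X] for small [d]. *)
Lemma compact_uniformly_continuous m (X : set 'rV[R]_n) (H : 'rV[R]_n -> 'rV[R]_m) (e : R) :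
  compact X -> (forall x, X x -> {for x, continuous H}) -> 0 < e ->
  exists2 d : R, 0 < d & forall x y, X x -> `|x - y| < d -> `|H x - H y| < e.
Proof.
move=> /compact_near_coveringP cX cH e0.
have : \forall d \near 0^'+, X `<=` [set x | forall y, `|x - y| < d -> `|H x - H y| < e].
  apply: cX => x Xx.
  have e2 : 0 < e / 2 by rewrite divr_gt0.
  have /cvgrPdist_lt/(_ _ e2) := cH x Xx.
  case/nbhs_ballP => r /= r0 xr.
  have r2 : 0 < r / 2 by rewrite divr_gt0.
  exists (ball x (r / 2), [set d | d < r / 2]).
    by split; [exact: nbhsx_ballx|exact: nbhs_right_lt].
  move=> [y d] /= [xy dr] z yz.
  have xyr : `|x - y| < r / 2 by rewrite -ball_normE in xy.
  have H1 : `|H x - H y| < e / 2.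
    apply: xr; rewrite -ball_normE /=; apply: (lt_trans xyr).
    by rewrite ltr_pdivrMr// mulr2n mulrDr mulr1 ltrDl.
  have H2 : `|H x - H z| < e / 2.
    apply: xr; rewrite -ball_normE /= [r]splitr.
    by rewrite (le_lt_trans (ler_distD y _ _))// ltrD// (lt_trans yz).
  by rewrite [e]splitr (le_lt_trans (ler_distD (H x) _ _))// ltrD// distrC.
case/(fun F => filter_ex (filterI F (nbhs_right_gt 0))) => d [Xd d0].
by exists d => // x y Xx; exact: Xd.
Qed.

(** A zero-free [H] would label each point of the cross-polytope by a coordinate of [H x] of largest
    modulus and its sign. Antipodes get opposite labels, only [m] indices occur, and a fine
    triangulation has no complementary edge, so Fan's lemma gives [n - 1 < m]. The origin is
    excluded so that [H] may be precomposed with a radial projection. *)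
Theorem Borsuk_Ulam m (H : 'rV[R]_n -> 'rV[R]_m) : (m < n)%N ->
  (forall x, x != 0 -> {for x, continuous H}) ->
  (forall x, x != 0 -> H (- x) = - H x) ->
  exists2 x, x != 0 & H x = 0.
Proof.
move=> mn cH oH; apply: contrapT => H0.
have {}H0 x : x != 0 -> H x != 0.
  by move=> x0; apply/eqP => Hx; apply: H0; exists x.
have n0 : (0 < n)%N by exact: leq_ltn_trans mn.
have X0 : cross_polytope !=set0.
  have e0 : [:: basis_vec R n 0] \in octahedral_hemisphere -%R (basis_vec R n) 0.
    exact: mem_head.
  have [eps e1 Hs] := octahedral_in_orthant_face n0 e0.
  by exists (basis_vec R n 0); apply: (orthant_face_norm1 e1); apply: Hs; exact: mem_head.
have cHX x : cross_polytope x -> {for x, continuous H}.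
  by move=> /cross_polytope_neq0; exact: cH.
have m0 : (0 < m)%N.
  case: m H {mn cH oH cHX} H0 => // H H0; have [x /cross_polytope_neq0/H0] := X0.
  by rewrite thinmx0 eqxx.
have [x0 x0X minH] : exists2 c, c \in cross_polytope &
    forall t, t \in cross_polytope -> `|H c| <= `|H t|.
  apply: compact_EVT_min => //; first exact: cross_polytope_compact.
  apply: continuous_in_subspaceT => x; rewrite inE => /cHX Hx.
  exact: (continuous_comp Hx (@norm_continuous _ _ _)).
have eta0 : 0 < `|H x0|.
  by rewrite normr_gt0 H0// cross_polytope_neq0//; rewrite inE in x0X.
have [d d0 dP] := compact_uniformly_continuous cross_polytope_compact cHX eta0.
have [Hs [Hh Ho Hd]] := small_hemispheres n d0.
have /choice[a aP] := fun x : 'rV[R]_n => norm_rV_attained (H x) m0.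
(* The choice depends only on the moduli of the coordinates, so [x] and [- x] get the same index;
   [a x] witnesses that the search succeeds. *)
pose idx x : 'I_m := odflt (a x) [pick i | `|H x ord0 i| == `|H x|].
have idxP x : `|H x ord0 (idx x)| = `|H x|.
  by rewrite /idx; case: pickP => [i /eqP//|_ /=]; exact: aP.
pose lab x : nat := ((idx x).*2 + (H x ord0 (idx x) < 0)%R)%N.
have lab_half x : (lab x)./2 = idx x.
  by rewrite /lab addnC half_bit_double.
have lab_odd x : odd (lab x) = (H x ord0 (idx x) < 0).
  by rewrite /lab oddD odd_double addFb oddb.
have faceX s v : in_orthant_face s -> v \in s -> cross_polytope v.
  by move=> [eps e1 es] /es; exact: orthant_face_norm1.
have labN x : x != 0 -> lab (- x) = flip (lab x).
  move=> x0'; have ixE : idx (- x) = idx x.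
    rewrite /idx; under eq_pick do rewrite oH// mxE !normrN.
    case: pickP => // xx; have := xx (a x); by rewrite aP eqxx.
  apply: half_odd_inj; first by rewrite half_flip !lab_half ixE.
  rewrite odd_flip !lab_odd ixE oH// mxE oppr_lt0 -leNgt le_eqVlt.
  suff : H x ord0 (idx x) != 0 by rewrite eq_sym => /negPf->.
  by rewrite -normr_eq0 idxP normr_eq0 H0.
(* Two vertices with the same index and opposite signs would differ in that coordinate by at least
   twice the minimum [|H x0|], against the choice of the mesh [d]. *)
have labnc j s : (j < n)%N -> s \in Hs j -> noncomplementary (map lab s).
  move=> jn sH _ _ /mapP[u us ->] /mapP[v vs ->]; rewrite !lab_half => /val_inj uv.
  apply: half_odd_inj; first by rewrite !lab_half uv.
  have uX := faceX _ _ (Ho j jn s sH) us; have vX := faceX _ _ (Ho j jn s sH) vs.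
  rewrite !lab_odd uv.
  have := dP u v uX (Hd j jn s sH u v us vs).
  move=> /(le_lt_trans (norm_coord_le _ (idx v))); rewrite !mxE.
  have := minH _ (mem_set uX); have := minH _ (mem_set vX).
  rewrite -(idxP u) -(idxP v) uv; move: eta0.
  move: (`|H x0|) (H u ord0 _) (H v ord0 _) => eta r t.
  case: (ltP r 0) => r0; case: (ltP t 0) => t0 // eta0.
    rewrite (ltr0_norm r0) (ger0_norm t0) => h1 h2; rewrite ltr_norml => /andP[]; lra.
  rewrite (ger0_norm r0) (ltr0_norm t0) => h1 h2; rewrite ltr_norml => /andP[]; lra.
have : (n.-1 < m)%N.
  apply: (Fan Hh (lab := lab)) => [j jn s sH v vs|j jn s sH|s sH v vs].
  - apply: labN; apply: cross_polytope_neq0; apply: faceX vs.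
    by apply: (Ho j) sH; rewrite -(prednK n0) ltnS.
  - by apply: (labnc j) => //; rewrite -(prednK n0) ltnS.
  - by rewrite lab_half.
by rewrite prednK// leqNgt mn.
Qed.

End Borsuk_Ulam.

(** * Power means and signed powers *)

Section power_mean.
Variable R : realType.
Implicit Types (x y a b p q r s : R).

(** Young's inequality for the product of [r] and 1, with [p] and its conjugate exponent. *)
Lemma powR_Bernoulli r p : 0 <= r -> 1 < p -> 1 + p * (r - 1) <= r `^ p.
Proof.
move=> r0 p1; have p0 : 0 < p by exact: lt_trans p1.
have q0 : 0 < 1 - p^-1 by rewrite subr_gt0 invf_lt1.
have := @conjugate_powR R r 1 p (1 - p^-1)^-1 r0 ler01 p0.
rewrite invr_gt0 q0 invrK subrKC powR1 mulr1 mul1r => /(_ isT erefl).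
rewrite -(ler_pM2l p0) mulrDr mulrCA divff ?gt_eqF// mulr1 mulrBr mulr1.
rewrite divff ?gt_eqF//; lra.
Qed.

Lemma powRB_le x y p : 0 <= y -> 0 < x -> 1 < p ->
  x `^ p - y `^ p <= p * (x - y) * x `^ (p - 1).
Proof.
move=> y0 x0 p1; have p0 : 0 < p by exact: lt_trans p1.
have yE : y `^ p = x `^ p * (y / x) `^ p.
  by rewrite -powRM ?divr_ge0 ?(ltW x0)// mulrCA divff ?gt_eqF// mulr1.
have := powR_Bernoulli (divr_ge0 y0 (ltW x0)) p1.
rewrite yE -(ler_pM2l (powR_gt0 p x0)) -(mulr_powRB1 (ltW x0) p0).
move: (x `^ (p - 1)) ((y / x) `^ p) => u v h.
suff -> : p * (x - y) * u = x * u - x * u * (1 + p * (y / x - 1)) by rewrite lerD2l lerN2.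
by field; rewrite gt_eqF.
Qed.

(* The error is uniform in [y] because near [y = 1] the arithmetic and geometric
   means of 1 and [y ^+ 2] agree to second order. *)
Lemma power_mean_unit y p : 0 <= y <= 1 -> 2 <= p ->
  y `^ p <= ((1 + y ^+ 2) / 2) `^ p <= y `^ p + 16 / p.
Proof.
move=> /andP[y0 y1] p2; set x := (1 + y ^+ 2) / 2.
have p1 : 1 < p by lra.
have p0 : 0 < p by lra.
have x0 : 0 < x by rewrite divr_gt0// ltr_pwDl// sqr_ge0.
have xyE : x - y = (1 - y) ^+ 2 / 2 by rewrite /x; field.
have yx : y <= x by rewrite -subr_ge0 xyE divr_ge0// sqr_ge0.
apply/andP; split.
  by apply: ge0_ler_powR => //; rewrite ?nnegrE ltW.
rewrite -lerBlDl (le_trans (powRB_le y0 x0 p1))// xyE.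
(* Since [x - 1 <= - (1 - y) / 2], the bound [ln x <= x - 1] gives [x ^ (p - 1) <= exp (- s)], and
   [exp s >= 1 + s ^ 2 / 2] absorbs the factor [(1 - y) ^ 2]. *)
set s := (p - 1) * (1 - y) / 2.
have s0 : 0 <= s by rewrite divr_ge0// mulr_ge0; lra.
have xs : x `^ (p - 1) <= (1 + s ^+ 2 / 2)^-1.
  rewrite /powR gt_eqF// (@le_trans _ _ (expR (- s)))//.
    rewrite ler_expR /s -mulrA -mulrN ler_wpM2l//; first lra.
    have -> : x = 1 + (x - 1) by rewrite addrC subrK.
    rewrite (le_trans (le_ln1Dx _))//; first lra.
    rewrite /x; have := mulr_ge0 y0 (_ : 0 <= 1 - y); nra.
  rewrite expRN lef_pV2 ?posrE ?expR_gt0//; last by rewrite ltr_pwDl// divr_ge0// sqr_ge0.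
  exact: (expR_ge1Dxn 1 s0).
have s2 : 0 < 1 + s ^+ 2 / 2 by rewrite ltr_pwDl// divr_ge0// sqr_ge0.
apply: (@le_trans _ _ (p * ((1 - y) ^+ 2 / 2) * (1 + s ^+ 2 / 2)^-1)).
  by rewrite ler_wpM2l// mulr_ge0 ?(ltW p0)// divr_ge0// sqr_ge0.
rewrite ler_pdivrMr// [leRHS]mulrAC ler_pdivlMr// /s.
have -> : 16 * (1 + ((p - 1) * (1 - y) / 2) ^+ 2 / 2) =
    16 + 2 * (p - 1) ^+ 2 * (1 - y) ^+ 2 by field.
have h0 := sqr_ge0 (1 - y).
(* For [p >= 2] one has [p <= 2 (p - 1)]; with the constant 16 the quadratic term alone then
   dominates. *)
have h1 : p ^+ 2 <= 4 * (p - 1) ^+ 2 by nra.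
nra.
Qed.

(** The unit case with [y = sqrt (a / b)], scaled by [b ^ p]. *)
Lemma power_mean_le a b p : 0 < a -> a <= b -> 2 <= p ->
  (a * b) `^ (p / 2) <= ((a + b) / 2) `^ p <= (a * b) `^ (p / 2) + 16 / p * b `^ p.
Proof.
move=> a0 ab p2; have b0 : 0 < b by exact: lt_le_trans ab.
have ab01 : 0 <= a / b <= 1 by rewrite divr_ge0 ?(ltW a0) ?(ltW b0)//= ler_pdivrMr// mul1r.
pose y := Num.sqrt (a / b).
have y01 : 0 <= y <= 1.
  rewrite sqrtr_ge0 /= -sqrtr1 ler_sqrt//; by case/andP: ab01.
have y2 : y ^+ 2 = a / b by rewrite sqr_sqrtr//; case/andP: ab01.
have -> : (a + b) / 2 = b * ((1 + y ^+ 2) / 2) by rewrite y2; field; rewrite gt_eqF.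
have -> : (a * b) `^ (p / 2) = b `^ p * y `^ p.
  have -> : a * b = (b * y) ^+ 2 by rewrite exprMn y2; field; rewrite gt_eqF.
  rewrite -powR_mulrn; last by rewrite mulr_ge0 ?(ltW b0)//; case/andP: y01.
  rewrite -powRrM mulrCA divff ?pnatr_eq0// mulr1 powRM ?(ltW b0)//.
  by case/andP: y01.
rewrite powRM ?(ltW b0)//; last by rewrite divr_ge0// addr_ge0// sqr_ge0.
rewrite [16 / p * _]mulrC -mulrDr.
have /andP[h1 h2] := power_mean_unit y01 p2.
by rewrite !ler_wpM2l// powR_ge0.
Qed.

(** The unit case at [y = 0]; it gives the vanishing terms the same constant as the convergent
    ones. *)
Lemma powR_half_le p : 2 <= p -> 2 `^ (- p) <= 16 / p.
Proof.
move=> p2; have y0 : 0 <= (0 : R) <= 1 by rewrite lexx ler01.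
have /andP[_] := power_mean_unit y0 p2.
rewrite expr0n addr0 powR0 ?add0r; last by rewrite gt_eqF; lra.
by rewrite mul1r -powR_inv1// -powRrM mulN1r.
Qed.

Definition spow r x := Num.sg x * `|x| `^ r.

Lemma spowN r x : spow r (- x) = - spow r x.
Proof. by rewrite /spow sgrN normrN mulNr. Qed.

Lemma spow_ge0 r x : 0 <= x -> r != 0 -> spow r x = x `^ r.
Proof.
move=> x0 r0; rewrite /spow ger0_norm//; move: x0; rewrite le_eqVlt.
by move=> /predU1P[<-|/gtr0_sg->]; rewrite ?sgr0 ?powR0 ?mul1r ?mul0r.
Qed.

Lemma norm_spow r x : r != 0 -> `|spow r x| = `|x| `^ r.
Proof.
move=> r0; rewrite /spow normrM normr_sg (ger0_norm (powR_ge0 _ _)).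
by have [->|] := eqVneq x 0; rewrite ?mul1r// normr0 powR0// mulr0.
Qed.

Lemma spowK r s : r != 0 -> r * s = 1 -> cancel (spow r) (spow s).
Proof.
move=> r0 rs x; rewrite {1}/spow norm_spow// -powRrM rs powRr1//.
rewrite /spow sgrM sgr_id; have [->|x0] := eqVneq x 0; first by rewrite normr0 !mulr0.
by rewrite [Num.sg (_ `^ _)]gtr0_sg ?powR_gt0 ?normr_gt0// mulr1 mulr_sg_norm.
Qed.

(** Constant near negative points, differentiable near positive ones; at 0 the value is below [e] as
    soon as the argument is below [e ^ (1 / r)]. *)
Lemma continuous_max0_powR r : 0 < r -> continuous (fun x => Num.max x 0 `^ r).
Proof.
move=> r0 x; have [x0|x0|->] := ltgtP x 0.
- have e : \forall y \near x, 0 = Num.max y 0 `^ r.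
    near=> y; have y0 : y < 0 by near: y; exact: lt_nbhsl.
    by rewrite (max_idPr (ltW y0)) powR0// gt_eqF.
  rewrite /prop_for /= /continuous_at (max_idPr (ltW x0)) powR0 ?gt_eqF//.
  apply: cvg_trans (near_eq_cvg e) _; exact: cvg_cst.
- have e : \forall y \near x, y `^ r = Num.max y 0 `^ r.
    near=> y; have y0 : 0 < y by near: y; exact: lt_nbhsr.
    by rewrite (max_idPl (ltW y0)).
  rewrite /prop_for /= /continuous_at (max_idPl (ltW x0)).
  apply: cvg_trans (near_eq_cvg e) _.
  have /derivable1_diffP/differentiable_continuous : derivable (fun y : R => y `^ r) (x : R) (1 : R).
    by apply: derivable_powR; rewrite in_itv/= x0.
  exact.
- rewrite /prop_for /= /continuous_at maxxx powR0 ?gt_eqF//.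
  apply/cvgrPdist_lt => e e0.
  have d0 : 0 < e `^ r^-1 by exact: powR_gt0.
  near=> y; rewrite sub0r normrN ger0_norm ?powR_ge0//.
  have yd : Num.max y 0 < e `^ r^-1.
    rewrite gt_max d0 andbT; near: y; exact: lt_nbhsl.
  have := gt0_ltr_powR r0 _ _ yd; rewrite -powRrM mulVf ?gt_eqF// powRr1 ?(ltW e0)//.
  by apply; rewrite nnegrE ?le_max ?lexx ?orbT ?powR_ge0.
Unshelve. all: by end_near. Qed.

Lemma spowE r x : r != 0 -> spow r x = Num.max x 0 `^ r - Num.max (- x) 0 `^ r.
Proof.
move=> r0; case: (leP 0 x) => x0.
  by rewrite spow_ge0// (max_idPr _) ?oppr_le0// powR0// subr0.
rewrite -[x]opprK spowN spow_ge0 ?oppr_ge0 ?(ltW x0)// opprK.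
by rewrite (max_idPl _) ?oppr_ge0 ?(ltW x0)// powR0// sub0r.
Qed.

Lemma continuous_spow r : 0 < r -> continuous (spow r).
Proof.
move=> r0 x; rewrite (_ : spow r = fun x => Num.max x 0 `^ r - Num.max (- x) 0 `^ r); last first.
  by apply/funext => y; rewrite spowE// gt_eqF.
apply: (@continuousB R R^o R (fun y => Num.max y 0 `^ r) (fun y => Num.max (- y) 0 `^ r)).
  exact: continuous_max0_powR.
apply: (@continuous_comp _ _ _ (-%R : R -> R) (fun y => Num.max y 0 `^ r)).
  exact: opp_continuous.
exact: continuous_max0_powR.
Qed.

Lemma continuous_norm_powR r : 0 < r -> continuous (fun x => `|x| `^ r).
Proof.
move=> r0 x; rewrite (_ : (fun x => _) = fun x => `|spow r x|); last first.
  by apply/funext => y; rewrite norm_spow// gt_eqF.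
apply: (@continuous_comp R R R (spow r) (fun y : R => `|y|)); first exact: continuous_spow.
exact: norm_continuous.
Qed.

End power_mean.

(** * Genus of the spheres and the edge estimate *)

(** By odd extension the test maps may be taken odd and continuous on the whole space, so they
    restrict to other sets and compose with homeomorphisms freely. *)
Lemma genus_geP (R : realType) n (B : set 'rV[R]_n) k :
  compact B -> closed B -> symmetric_set B ->
  genus_ge B k <->
  forall m (H : 'rV[R]_n -> 'rV[R]_m), (m < k)%N -> continuous H ->
    (forall x, H (- x) = - H x) -> exists2 x, B x & H x = 0.
Proof.
move=> cB clB sB; split=> [gB m H mk cH oH|BH m mk [h [ch oh h0]]].
  apply: contrapT => H0; apply: (gB m mk); exists H; split=> //.
    exact: continuous_subspaceT.
  by move=> x Bx; apply/eqP => Hx; apply: H0; exists x.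
have [H [cH oH Hh]] := odd_extension cB clB sB ch oh.
have [x Bx Hx] := BH m H mk cH oH.
by have := h0 x Bx; rewrite -Hh// Hx eqxx.
Qed.

Section spow_rV.
Variables (R : realType) (n : nat).
Implicit Types (f g : 'rV[R]_n) (r s : R).

Definition spow_rV r f : 'rV[R]_n := \row_i spow r (f ord0 i).

Lemma spow_rVN r f : spow_rV r (- f) = - spow_rV r f.
Proof. by apply/rowP => i; rewrite !mxE spowN. Qed.

Lemma spow_rVK r s : r != 0 -> r * s = 1 -> cancel (spow_rV r) (spow_rV s).
Proof. by move=> r0 rs f; apply/rowP => i; rewrite !mxE spowK. Qed.

Lemma continuous_spow_rV r : 0 < r -> continuous (spow_rV r).
Proof.
move=> r0 f; apply: continuous_row => j.
rewrite (_ : (fun y => _) = fun y : 'rV[R]_n => spow r (y ord0 j)); last first.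
  by apply/funext => y; rewrite mxE.
apply: (@continuous_comp _ _ _ (fun y : 'rV[R]_n => y ord0 j) (spow r)).
  exact: coord_continuous.
exact: continuous_spow.
Qed.

End spow_rV.

Section sphere.
Variables (R : realType) (n : nat) (mu : 'I_n -> R).
Hypothesis mu_gt0 : forall i, 0 < mu i.
Implicit Types (f g : 'rV[R]_n) (p q : R).

Lemma pnorm_p_spow p q g : 0 < p -> 0 < q ->
  pnorm_p mu p (spow_rV (q / p) g) = pnorm_p mu q g.
Proof.
move=> p0 q0; apply: eq_bigr => i _; rewrite mxE norm_spow; last first.
  by rewrite gt_eqF// divr_gt0.
by rewrite -powRrM -mulrA mulVf ?mulr1// gt_eqF.
Qed.

Lemma continuous_pnorm_p p : 0 < p -> continuous (pnorm_p mu p).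
Proof.
move=> p0 f; apply: continuous_sum => i _.
apply: (@continuousM _ _ (fun=> mu i)); first exact: cst_continuous.
apply: (@continuous_comp _ _ _ (fun y : 'rV[R]_n => y ord0 i) (fun x => `|x| `^ p)).
  exact: coord_continuous.
exact: continuous_norm_powR.
Qed.

Lemma pnorm_p_gt0 p f : f != 0 -> 0 < pnorm_p mu p f.
Proof.
move=> f0; have [i fi] : exists i, f ord0 i != 0.
  apply: contrapT => H; move/eqP: f0; apply; apply/rowP => i; rewrite mxE.
  by apply/eqP/negPn/negP => fi; apply: H; exists i.
rewrite /pnorm_p (bigD1 i)//= ltr_pwDl//.
  by rewrite mulr_gt0// powR_gt0// normr_gt0.
by rewrite sumr_ge0// => j _; rewrite mulr_ge0 ?powR_ge0// ltW.
Qed.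

Lemma pnorm_pZ p c f : 0 <= c -> pnorm_p mu p (c *: f) = c `^ p * pnorm_p mu p f.
Proof.
move=> c0; rewrite /pnorm_p big_distrr/=; apply: eq_bigr => i _.
by rewrite mxE normrM (ger0_norm c0) powRM// mulrCA.
Qed.

Lemma pnorm_pN p f : pnorm_p mu p (- f) = pnorm_p mu p f.
Proof. by apply: eq_bigr => i _; rewrite mxE normrN. Qed.

Lemma sphere_coord_le q g i : sphere_p mu q g -> `|g ord0 i| `^ q <= \sum_j (mu j)^-1.
Proof.
move=> gS; rewrite (@le_trans _ _ (mu i)^-1)//; last first.
  by rewrite (bigD1 i)//= lerDl sumr_ge0// => j _; rewrite invr_ge0 ltW.
rewrite -[leRHS]mul1r ler_pdivlMr// mulrC -[leRHS]gS /pnorm_p (bigD1 i)//= lerDl.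
by rewrite sumr_ge0// => j _; rewrite mulr_ge0 ?powR_ge0// ltW.
Qed.

Lemma sphere_closed q : 0 < q -> closed (sphere_p mu q).
Proof.
move=> q0; exact: ((continuous_closedP _).1 (continuous_pnorm_p q0) _ (@closed_eq R 1)).
Qed.

Lemma sphere_compact q : 0 < q -> compact (sphere_p mu q).
Proof.
move=> q0; apply: bounded_closed_compact; last exact: sphere_closed.
exists ((\sum_j (mu j)^-1) `^ q^-1); split; first exact: num_real.
move=> M /ltW M1 g /= gS; apply: norm_rV_le => [|i].
  by apply: le_trans M1; exact: powR_ge0.
apply: le_trans M1.
rewrite -[leLHS]powRr1// -(@divff _ q) ?gt_eqF// powRrM.
apply: ge0_ler_powR; rewrite ?invr_ge0 ?(ltW q0) ?nnegrE ?powR_ge0//.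
  by rewrite sumr_ge0// => j _; rewrite invr_ge0 ltW.
exact: sphere_coord_le.
Qed.

Lemma sphere_symmetric q : symmetric_set (sphere_p mu q).
Proof.
by move=> f; rewrite /sphere_p /= pnorm_pN.
Qed.

Lemma subsphere_compact q (B : set 'rV[R]_n) : 0 < q ->
  B `<=` sphere_p mu q -> closed B -> compact B.
Proof. by move=> q0 BS clB; apply: subclosed_compact clB (sphere_compact q0) BS. Qed.

Lemma sphere_genus q : 0 < q -> genus_ge (sphere_p mu q) n.
Proof.
move=> q0; apply/genus_geP.
- exact: sphere_compact.
- exact: sphere_closed.
- exact: sphere_symmetric.
move=> m H mn cH oH.
(* Radial projection onto the sphere; the exponent matches the degree [q] of [pnorm_p]. It is
   controlled only away from the origin. *)
pose N f := (pnorm_p mu q f) `^ (- q^-1) *: f.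
have cN x : x != 0 -> {for x, continuous (H \o N)}.
  move=> x0; apply: continuous_comp; last exact: cH.
  apply: continuousZ; last exact: cvg_id.
  apply: (@continuous_comp _ _ _ (pnorm_p mu q) (fun y => y `^ (- q^-1))).
    exact: continuous_pnorm_p.
  have /derivable1_diffP/differentiable_continuous :
      derivable (fun y : R => y `^ (- q^-1)) (pnorm_p mu q x : R) (1 : R).
    by apply: derivable_powR; rewrite in_itv/= pnorm_p_gt0.
  exact.
have oN x : x != 0 -> (H \o N) (- x) = - (H \o N) x.
  move=> _; have NN : N (- x) = - N x by rewrite /N pnorm_pN scalerN.
  by rewrite /comp NN oH.
have [x x0 Hx] := Borsuk_Ulam mn cN oN.
exists (N x) => //; rewrite /sphere_p /= pnorm_pZ ?powR_ge0// -powRrM.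
rewrite mulNr mulVf ?gt_eqF// powR_inv1 ?mulVf ?gt_eqF ?pnorm_p_gt0//.
exact/ltW/pnorm_p_gt0.
Qed.

Lemma genus_family_sphere q k : 0 < q -> (k <= n)%N ->
  genus_family (sphere_p mu q) k (sphere_p mu q).
Proof.
move=> q0 kn; split=> //; first exact: sphere_closed.
  exact: sphere_symmetric.
by move=> m mk; apply: sphere_genus => //; exact: leq_trans kn.
Qed.

(** The empty set maps vacuously to the nonzero vectors of dimension 0, so it has genus 0. *)
Lemma genus_family_nonempty q k B : (0 < k)%N -> genus_family (sphere_p mu q) k B ->
  B !=set0.
Proof.
move=> k0 [_ _ _ gB]; apply: contrapT => B0; apply: (gB 0%N k0).
exists (fun=> 0); split.
- by move=> x; exact: cst_continuous.
- by move=> x Bx; exfalso; apply: B0; exists x.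
- by move=> x Bx; exfalso; apply: B0; exists x.
Qed.

Lemma genus_family_spow p q k B : 0 < p -> 0 < q ->
  genus_family (sphere_p mu q) k B ->
  genus_family (sphere_p mu p) k (spow_rV (q / p) @` B).
Proof.
move=> p0 q0 [BS clB sB gB].
have r0 : 0 < q / p by rewrite divr_gt0.
have r'0 : 0 < p / q by rewrite divr_gt0.
have rK : cancel (@spow_rV R n (q / p)) (spow_rV (p / q)).
  by apply: spow_rVK; rewrite ?gt_eqF//; field; rewrite !gt_eqF.
have r'K : cancel (@spow_rV R n (p / q)) (spow_rV (q / p)).
  by apply: spow_rVK; rewrite ?gt_eqF//; field; rewrite !gt_eqF.
(* The image is a preimage under the inverse map, which makes it closed. *)
have BE : spow_rV (q / p) @` B = spow_rV (p / q) @^-1` B.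
  apply/seteqP; split=> [_ [g Bg <-]|f Bf]; first by rewrite /preimage /= rK.
  by exists (spow_rV (p / q) f).
have BpS : spow_rV (q / p) @` B `<=` sphere_p mu p.
  by move=> _ [g /BS gS <-]; rewrite /sphere_p /= pnorm_p_spow.
have clBp : closed (spow_rV (q / p) @` B).
  rewrite BE; apply: (continuous_closedP _).1 clB; exact: continuous_spow_rV.
have sBp : symmetric_set (spow_rV (q / p) @` B).
  by move=> _ [g Bg <-]; exists (- g); rewrite ?spow_rVN//; exact: sB.
split=> //; apply/(genus_geP _ (subsphere_compact p0 BpS clBp) clBp sBp).
move=> m H mk cH oH.
have cHs : continuous (H \o spow_rV (q / p)).
  by move=> x; apply: continuous_comp; [exact: continuous_spow_rV|exact: cH].
have oHs x : (H \o spow_rV (q / p)) (- x) = - (H \o spow_rV (q / p)) x.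
  by rewrite /= spow_rVN oH.
have [x Bx Hx] := (genus_geP k (subsphere_compact q0 BS clB) clB sB).1 gB m _ mk cHs oHs.
by exists (spow_rV (q / p) x) => //; exists x.
Qed.

End sphere.

(** * Limit of a single edge term *)

Section edge_term.
Variable R : realType.
Implicit Types x z p q M : R.

(** For [a = x ^ (q / p)] and [b = z ^ (q / p)], the two terms are the [p]-th powers of the
    arithmetic and the geometric mean of [a] and [b], and [b ^ p = z ^ q]. *)
Lemma edge_term_pos x z p q : 0 < q -> 2 <= p -> 0 < x -> x <= z ->
  `|2 `^ (- p) * `|spow (q / p) x + spow (q / p) z| `^ p
    - Num.max (x * z) 0 `^ (q / 2)| <= 16 / p * z `^ q.
Proof.
move=> q0 p2 x0 xz; have z0 : 0 < z by exact: lt_le_trans xz.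
have p0 : 0 < p by lra.
have r0 : 0 < q / p by rewrite divr_gt0.
have rn : q / p != 0 by rewrite gt_eqF.
rewrite !spow_ge0 ?(ltW x0) ?(ltW z0)// (max_idPl _) ?mulr_ge0 ?(ltW x0) ?(ltW z0)//.
have a0 : 0 < x `^ (q / p) by exact: powR_gt0.
have b0 : 0 < z `^ (q / p) by exact: powR_gt0.
have ab : x `^ (q / p) <= z `^ (q / p).
  exact: (ge0_ler_powR (ltW r0) (ltW x0 : x \in Num.nneg) (ltW z0 : z \in Num.nneg) xz).
rewrite [`|x `^ _ + _|]ger0_norm; last by rewrite addr_ge0 ?(ltW a0) ?(ltW b0).
rewrite mulrC powRN -[(2 `^ p)^-1]powR_inv1 ?powR_ge0// powRAC.
rewrite powR_inv1// -powRM ?invr_ge0//; last by rewrite addr_ge0 ?(ltW a0) ?(ltW b0).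
have -> : (x * z) `^ (q / 2) = (x `^ (q / p) * z `^ (q / p)) `^ (p / 2).
  rewrite -powRM ?(ltW x0) ?(ltW z0)// -powRrM; congr (_ `^ _); field.
  by rewrite gt_eqF.
have -> : z `^ q = (z `^ (q / p)) `^ p.
  by rewrite -powRrM -mulrA mulVf ?mulr1// gt_eqF.
have /andP[h1 h2] := power_mean_le a0 ab p2.
by rewrite ger0_norm ?subr_ge0// lerBlDl.
Qed.

(** Here [z] stands for [- sigma i j * g j]. Equal signs reduce by symmetry to the ordered positive
    case. For opposite signs the limit term vanishes and the sum has at most the larger of the two
    moduli, so the factor [2 ^ (- p)] survives. *)
Lemma edge_term_le x z p q M : 0 < q -> 2 <= p ->
  `|x| `^ q <= M -> `|z| `^ q <= M ->
  `|2 `^ (- p) * `|spow (q / p) x + spow (q / p) z| `^ p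
    - Num.max (x * z) 0 `^ (q / 2)| <= 16 / p * M.
Proof.
move=> q0 p2; have p0 : 0 < p by lra.
have c0 : 0 <= 16 / p by rewrite divr_ge0// ltW.
have rn : q / p != 0 by rewrite gt_eqF// divr_gt0.
have pos a b : 0 < a -> 0 < b -> `|a| `^ q <= M -> `|b| `^ q <= M ->
  `|2 `^ (- p) * `|spow (q / p) a + spow (q / p) b| `^ p
    - Num.max (a * b) 0 `^ (q / 2)| <= 16 / p * M.
  move=> a0 b0; rewrite (gtr0_norm a0) (gtr0_norm b0) => aM bM; case: (leP a b) => ab.
    by apply: (le_trans (edge_term_pos q0 p2 a0 ab)); rewrite ler_wpM2l.
  rewrite [spow _ _ + _]addrC (mulrC a); apply: (le_trans (edge_term_pos q0 p2 b0 (ltW ab))).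
  by rewrite ler_wpM2l.
have opp a b : 0 <= a -> b <= 0 -> `|a| `^ q <= M -> `|b| `^ q <= M ->
  `|2 `^ (- p) * `|spow (q / p) a + spow (q / p) b| `^ p
    - Num.max (a * b) 0 `^ (q / 2)| <= 16 / p * M.
  move=> a0 b0 aM bM; rewrite (max_idPr _) ?mulr_ge0_le0// powR0; last first.
    by rewrite gt_eqF// divr_gt0.
  have sa : 0 <= spow (q / p) a by rewrite spow_ge0// powR_ge0.
  have sb : spow (q / p) b <= 0.
    by rewrite -[b]opprK spowN oppr_le0 spow_ge0 ?oppr_ge0// powR_ge0.
  have powM y : `|y| `^ q <= M -> `|spow (q / p) y| `^ p <= M.
    by rewrite norm_spow// -powRrM -mulrA mulVf ?mulr1// gt_eqF.
  rewrite subr0 ger0_norm ?mulr_ge0 ?powR_ge0//.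
  apply: ler_pM; rewrite ?powR_ge0//; first exact: powR_half_le.
  have mono (u v : R) : `|u| <= `|v| -> `|u| `^ p <= `|v| `^ p.
    by move=> uv; apply: ge0_ler_powR; rewrite ?nnegrE ?(ltW p0).
  have [ab|ab] := leP (- spow (q / p) b) (spow (q / p) a).
    apply: le_trans (powM _ aM); apply: mono; rewrite ger0_norm; last lra.
    rewrite ger0_norm//; lra.
  apply: le_trans (powM _ bM); apply: mono; rewrite ler0_norm; last lra.
  rewrite ler0_norm//; lra.
move=> xM zM; have [x0|x0|xE] := ltgtP x 0.
- have [z0|z0] := leP 0 z.
    by rewrite [spow _ _ + _]addrC (mulrC x); apply: opp => //; exact: ltW.
  rewrite -[x]opprK -[z]opprK mulrNN !(spowN _ (- _)) -opprD normrN.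
  by apply: pos; rewrite ?oppr_gt0 ?normrN.
- have [z0|z0] := leP z 0; last exact: pos.
  by apply: opp => //; exact: ltW.
- have [z0|z0] := leP z 0; first by apply: opp => //; rewrite xE.
  by rewrite [spow _ _ + _]addrC (mulrC x); apply: opp; rewrite ?(ltW z0)// xE.
Qed.

End edge_term.

(** * Min-max values *)

(** Each competitor for [F] yields one on which [F'] is dominated, so the infima compare. [K] and
    [K'] make the suprema and the left infimum genuine instead of default values on unbounded
    sets. *)
Lemma minmax_le (R : realType) (T U : Type) (A : set (set T)) (A' : set (set U))
    (F : T -> R) (F' : U -> R) (a b K K' : R) :
  0 < a -> A !=set0 ->
  (forall B, A B -> B !=set0) -> (forall B, A' B -> B !=set0) ->
  (forall B x, A B -> B x -> F x <= K) ->
  (forall B y, A' B -> B y -> `|F' y| <= K') ->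
  (forall B, A B -> exists2 B', A' B' &
     forall y, B' y -> exists2 x, B x & F' y <= a * F x + b) ->
  inf [set sup (F' @` B) | B in A'] <= a * inf [set sup (F @` B) | B in A] + b.
Proof.
move=> a0 [B0 AB0] A0 A'0 FK F'K AA'.
rewrite -lerBlDr mulrC -ler_pdivrMr//; apply: lb_le_inf.
  by exists (sup (F @` B0)); exists B0.
move=> _ [B AB <-]; have [B' AB' BB'] := AA' B AB.
rewrite ler_pdivrMr// mulrC lerBlDr.
apply: (@le_trans _ _ (sup (F' @` B'))).
  apply: ge_inf; last by exists B'.
  exists (- K') => _ [D AD <-]; have [y Dy] := A'0 D AD.
  have /ler_normlP[h _] := F'K D y AD Dy.
  apply: (@le_trans _ _ (F' y)); first by rewrite lerNl.
  apply: ub_le_sup; last by exists y.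
  by exists K' => _ [z Dz <-]; exact: le_trans (ler_norm _) (F'K D z AD Dz).
apply: ge_sup.
  by have [y By] := A'0 B' AB'; exists (F' y); exists y.
move=> _ [y By <-]; have [x Bx yx] := BB' y By.
rewrite (le_trans yx)// lerD2r ler_pM2l//; apply: ub_le_sup; last by exists x.
by exists K => _ [z Bz <-]; exact: FK Bz.
Qed.

(* The sublevel set of the min-max value [c] is itself optimal: a zero-free odd
   map on it would have all its zeros in [S] strictly above [c], hence would be
   zero-free on some competitor. *)
Lemma minmax_attained (R : realType) n (S : set 'rV[R]_n) (F : 'rV[R]_n -> R) k :
  (0 < k)%N -> compact S -> closed S -> symmetric_set S ->
  continuous F -> (forall x, F (- x) = F x) ->
  genus_family S k !=set0 ->
  (forall B, genus_family S k B -> B !=set0) ->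
  let c := inf [set sup (F @` B) | B in genus_family S k] in
  exists B, [/\ genus_family S k B, (forall x, B x -> F x <= c) &
                exists2 x, B x & F x = c].
Proof.
move=> k0 cS clS sS cF eF [B0 GB0] GF0 c.
have subc (B : set 'rV[R]_n) : B `<=` S -> closed B -> compact B.
  by move=> BS clB; apply: subclosed_compact clB cS BS.
have S0 : S !=set0.
  by have [x Bx] := GF0 _ GB0; exists x; have [BS _ _ _] := GB0; exact: BS.
have [z zS zmin] := compact_EVT_min S0 cS (continuous_subspaceT cF).
have [z' zS' zmax] := compact_EVT_max S0 cS (continuous_subspaceT cF).
have supP B x : genus_family S k B -> B x -> F x <= sup (F @` B).
  move=> [BS _ _ _] Bx; apply: ub_le_sup; last by exists x.
  by exists (F z') => _ [y /BS Sy <-]; apply: zmax; exact/mem_set.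
pose B := S `&` [set x | F x <= c].
have BS : B `<=` S by move=> x [].
have clB : closed B.
  apply: closedI => //; exact: ((continuous_closedP _).1 cF _ (@closed_le R c)).
have sB : symmetric_set B by move=> x [Sx Fx]; split; [exact: sS|rewrite /= eF].
have GB : genus_family S k B.
  split=> //; apply/(genus_geP k (subc B BS clB) clB sB) => m H mk cH oH.
  (* [Z] meets every competitor, so the minimum of [F] over [Z] is at most each supremum, hence at
     most [c]; a minimiser is a zero of [H] lying in [B]. *)
  pose Z := S `&` [set x | H x = 0].
  have zeroZ D : genus_family S k D -> exists2 x, D x & Z x.
    move=> [DS clD sD gD].
    have [x Dx Hx] := (genus_geP k (subc D DS clD) clD sD).1 gD m H mk cH oH.
    by exists x => //; split=> //; exact: DS.
  have clZ : closed Z.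
    apply: closedI => //; have -> : [set x | H x = 0] = [set x | `|H x| = 0].
      by apply/seteqP; split=> x /= [/eqP]; rewrite ?normr_eq0 => /eqP // ->; rewrite normr0.
    have cnH : continuous (fun x => `|H x|).
      by move=> x; exact: (continuous_comp (cH x) (@norm_continuous _ _ _)).
    exact: ((continuous_closedP _).1 cnH _ (@closed_eq R 0)).
  have Z0 : Z !=set0 by have [x _ Zx] := zeroZ _ GB0; exists x.
  have ZS : Z `<=` S by move=> x [].
  have [y yZ ymin] := compact_EVT_min Z0 (subc Z ZS clZ) (continuous_subspaceT cF).
  move: yZ; rewrite inE => -[Sy Hy]; exists y => //; split=> //=.
  apply: lb_le_inf; first by exists (sup (F @` B0)); exists B0.
  move=> _ [D GD <-]; have [x Dx Zx] := zeroZ D GD.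
  by apply: (le_trans _ (supP D x GD Dx)); apply: ymin; exact/mem_set.
exists B; split=> //; first by move=> x [].
have B_neq0 := GF0 B GB.
have [x + xmax] := compact_EVT_max B_neq0 (subc B BS clB) (continuous_subspaceT cF).
rewrite inE => Bx; exists x => //; apply/eqP; rewrite eq_le; apply/andP; split.
  by case: Bx.
apply: (@le_trans _ _ (sup (F @` B))).
  apply: ge_inf; last by exists B.
  exists (F z) => _ [D GD <-]; have [y Dy] := GF0 D GD.
  have [DS _ _ _] := GD.
  by apply: (le_trans _ (supP D y GD Dy)); apply: zmin; exact/mem_set/DS.
apply: ge_sup; first by exists (F x); exists x.
by move=> _ [y By <-]; apply: xmax; exact/mem_set.
Qed.

(** * Comparison of the Rayleigh quotients *)

Section rayleigh.
Variables (R : realType) (n : nat) (adj : rel 'I_n).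
Variables (w sigma : 'I_n -> 'I_n -> R) (mu kappa : 'I_n -> R).
Hypothesis w_gt0 : forall i j, adj i j -> 0 < w i j.
Hypothesis sigma1 : forall i j, adj i j -> sigma i j = 1 \/ sigma i j = -1.
Hypothesis mu_gt0 : forall i, 0 < mu i.

(** The numerator alone is continuous on the whole space, as the attainment argument requires, and
    equals the quotient on the sphere. *)
Definition qinf_energy (q : R) (g : 'rV[R]_n) : R :=
  edge_sum adj (fun i j =>
      w i j * (Num.max (- (g ord0 i * sigma i j * g ord0 j)) 0) `^ (q / 2)).

Lemma rayleigh_qinf_sphere q g : sphere_p mu q g ->
  rayleigh_qinf adj w sigma mu q g = qinf_energy q g.
Proof. by rewrite /sphere_p /rayleigh_qinf /= => ->; rewrite divr1. Qed.

Lemma qinf_energyN q g : qinf_energy q (- g) = qinf_energy q g.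
Proof.
by apply: eq_bigr => i _; apply: eq_bigr => j _; rewrite !mxE mulNr mulrNN.
Qed.

Lemma continuous_qinf_energy q : 0 < q -> continuous (qinf_energy q).
Proof.
move=> q0 g; apply: continuous_sum => i _; apply: continuous_sum => j _.
apply: (@continuousM _ _ (fun=> w i j)); first exact: cst_continuous.
apply: (@continuous_comp _ _ _
  (fun g : 'rV[R]_n => - (g ord0 i * sigma i j * g ord0 j))
  (fun x => Num.max x 0 `^ (q / 2))); last first.
  by apply: continuous_max0_powR; rewrite divr_gt0.
apply: continuousN; apply: continuousM; last exact: coord_continuous.
apply: (@continuousM _ _ (fun g : 'rV[R]_n => g ord0 i) (fun=> sigma i j)).
  exact: coord_continuous.
exact: cst_continuous.
Qed.

(** Each edge costs [w i j * (16 / p * M)] by the edge estimate. The potential term has modulus at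
    most [K * M] and carries the factor [2 ^ (- p) <= 16 / p], so [kappa] disappears in the
    limit. *)
Lemma rayleigh_p_approx q : 0 < q -> exists2 C : R, 0 <= C &
  forall p g, 2 <= p -> sphere_p mu q g ->
    `|2 `^ (- p) * rayleigh_p adj w sigma mu kappa p (spow_rV (q / p) g)
      - rayleigh_qinf adj w sigma mu q g| <= C / p.
Proof.
move=> q0; pose M := \sum_j (mu j)^-1.
have M0 : 0 <= M by rewrite sumr_ge0// => j _; rewrite invr_ge0 ltW.
have w0 (i j : 'I_n) : (i < j)%N && adj i j -> 0 <= w i j by move=> /andP[_ /w_gt0/ltW].
pose W := edge_sum adj w; pose K := \sum_i `|kappa i|.
have W0 : 0 <= W by apply: sumr_ge0 => i _; apply: sumr_ge0 => j; exact: w0.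
have K0 : 0 <= K by exact: sumr_ge0.
exists (16 * M * (W + K)); first by rewrite !mulr_ge0// addr_ge0.
move=> p g p2 gS; have p0 : 0 < p by lra.
have gM i : `|g ord0 i| `^ q <= M by exact: sphere_coord_le.
rewrite rayleigh_qinf_sphere// /rayleigh_p pnorm_p_spow// gS divr1 mulrDr addrAC.
have -> : 16 * M * (W + K) / p = W * (16 / p * M) + 16 / p * (K * M).
  by field; rewrite gt_eqF.
rewrite (le_trans (ler_normD _ _))// lerD//.
  rewrite /qinf_energy /W /edge_sum big_distrr/= -sumrB big_distrl/=.
  rewrite (le_trans (ler_norm_sum _ _ _))//; apply: ler_sum => i _.
  rewrite big_distrr/= -sumrB big_distrl/=.
  rewrite (le_trans (ler_norm_sum _ _ _))//; apply: ler_sum => j ij.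
  rewrite mulrCA -mulrBr normrM ger0_norm ?w0// ler_wpM2l ?w0//.
  have /sigma1 s1 : adj i j by case/andP: ij.
  have -> : spow_rV (q / p) g ord0 i - sigma i j * spow_rV (q / p) g ord0 j =
      spow (q / p) (g ord0 i) + spow (q / p) (- sigma i j * g ord0 j).
    rewrite !mxE; case: s1 => ->; first by rewrite mul1r mulN1r spowN.
    by rewrite mulN1r opprK opprK mul1r.
  have -> : - (g ord0 i * sigma i j * g ord0 j) = g ord0 i * (- sigma i j * g ord0 j).
    by rewrite mulNr mulrN mulrA.
  apply: edge_term_le => //.
  by rewrite normrM normrN; case: s1 => ->; rewrite ?normrN normr1 mul1r.
rewrite normrM (ger0_norm (powR_ge0 _ _)).
apply: ler_pM; rewrite ?powR_ge0//; first exact: powR_half_le.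
rewrite (le_trans (ler_norm_sum _ _ _))// /K big_distrl/=; apply: ler_sum => i _.
rewrite normrM (ger0_norm (powR_ge0 _ _)) ler_wpM2l// mxE norm_spow; last first.
  by rewrite gt_eqF// divr_gt0.
by rewrite -powRrM -mulrA mulVf ?mulr1// gt_eqF.
Qed.

Lemma qinf_bounded q : 0 < q -> exists K : R, forall g, sphere_p mu q g ->
  `|rayleigh_qinf adj w sigma mu q g| <= K.
Proof.
move=> q0; have [S0|/set0P S0] := eqVneq (sphere_p mu q) set0.
  by exists 0 => g; rewrite S0.
have cn : continuous (fun g => `|qinf_energy q g|).
  move=> g; apply: (@continuous_comp _ _ _ (qinf_energy q) (fun x : R => `|x|)).
    exact: continuous_qinf_energy.
  exact: norm_continuous.
have [z _ zmax] := compact_EVT_max S0 (sphere_compact mu_gt0 q0) (continuous_subspaceT cn).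
exists `|qinf_energy q z| => g gS; rewrite rayleigh_qinf_sphere//.
by apply: zmax; exact/mem_set.
Qed.

Lemma var_eig_approx k q : 0 < q -> (0 < k <= n)%N -> exists2 C : R, 0 <= C &
  forall p, 2 <= p ->
    `|minmax_qinf adj w sigma mu k q
      - 2 `^ (- p) * var_eig adj w sigma mu kappa k p| <= C / p.
Proof.
move=> q0 /andP[k0 kn]; have [C C0 HC] := rayleigh_p_approx q0.
have [K HK] := qinf_bounded q0.
exists C => // p p2; have p0 : 0 < p by lra.
have a0 : 0 < 2 `^ p :> R by exact: powR_gt0.
have aV : 2 `^ (- p) = (2 `^ p)^-1 :> R by rewrite powRN.
have r0 : q / p != 0 by rewrite gt_eqF// divr_gt0.
have r'0 : p / q != 0 by rewrite gt_eqF// divr_gt0.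
have rr' : p / q * (q / p) = 1 by field; rewrite !gt_eqF.
have toq f : sphere_p mu p f -> sphere_p mu q (spow_rV (p / q) f).
  by rewrite /sphere_p /= pnorm_p_spow.
have HC' f : sphere_p mu p f ->
    `|2 `^ (- p) * rayleigh_p adj w sigma mu kappa p f
      - rayleigh_qinf adj w sigma mu q (spow_rV (p / q) f)| <= C / p.
  by move=> /toq/(HC p _ p2); rewrite spow_rVK.
(* The bound on the [p]-quotient is read off its closeness to the bounded limit quotient. *)
have HK' f : sphere_p mu p f ->
    `|rayleigh_p adj w sigma mu kappa p f| <= 2 `^ p * (K + C / p).
  move=> fS; have := HC' f fS; have := HK _ (toq f fS).
  rewrite aV; move: (rayleigh_p _ _ _ _ _ _ _) (rayleigh_qinf _ _ _ _ _ _) => u v vK uv.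
  rewrite -ler_pdivrMl// -{1}(gtr0_norm a0) -normfV -normrM -[_ * u](subrK v).
  by rewrite (le_trans (ler_normD _ _))// addrC lerD.
have spq : genus_family (sphere_p mu q) k !=set0.
  by exists (sphere_p mu q); exact: genus_family_sphere.
have spp : genus_family (sphere_p mu p) k !=set0.
  by exists (sphere_p mu p); exact: genus_family_sphere.
have GFS r (B : set 'rV[R]_n) x : genus_family (sphere_p mu r) k B -> B x -> sphere_p mu r x.
  by move=> [BS _ _ _] /BS.
have GF0 r (B : set 'rV[R]_n) : genus_family (sphere_p mu r) k B -> B !=set0.
  exact: genus_family_nonempty.
rewrite ler_distl; apply/andP; split.
  (* Competitors are pushed from [S_q] to [S_p], with scaling factor [2 ^ p]. *)
  rewrite lerBlDr aV ler_pdivrMl// mulrDr.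
  apply: (@minmax_le _ _ _ _ _ _ _ _ _ K (2 `^ p * (K + C / p))) => //;
    [exact: GF0|exact: GF0|..].
  - move=> B x GB Bx; exact: le_trans (ler_norm _) (HK x (GFS _ _ _ GB Bx)).
  - move=> B y GB By; exact: HK' (GFS _ _ _ GB By).
  - move=> B GB; exists (spow_rV (q / p) @` B); first exact: genus_family_spow.
    move=> _ [x Bx <-]; exists x => //.
    rewrite -mulrDr -ler_pdivrMl// -aV -lerBlDl.
    exact: le_trans (ler_norm _) (HC p x p2 (GFS _ _ _ GB Bx)).
(* Competitors are pulled back from [S_p] to [S_q], with scaling factor [2 ^ (- p)]. *)
apply: (@minmax_le _ _ _ _ _ _ _ _ _ (2 `^ p * (K + C / p)) K) => //.
- exact: GF0.
- exact: GF0.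
- move=> B x GB Bx; exact: le_trans (ler_norm _) (HK' x (GFS _ _ _ GB Bx)).
- move=> B y GB By; exact: HK (GFS _ _ _ GB By).
- move=> B GB; exists (spow_rV (p / q) @` B); first exact: genus_family_spow.
  move=> _ [x Bx <-]; exists x => //.
  have := HC' x (GFS _ _ _ GB Bx); rewrite distrC => h.
  by rewrite -lerBlDl (le_trans (ler_norm _) h).
Qed.

End rayleigh.

Unset Implicit Arguments.

Theorem theorem4p4 (R : realType) (n : nat) (adj : rel 'I_n)
  (w sigma : 'I_n -> 'I_n -> R) (mu kappa : 'I_n -> R) (k : nat) (q : R) :
  (forall i j, adj i j = adj j i) ->
  (forall i, ~~ adj i i) ->
  (forall i j, adj i j -> 0 < w i j /\ w i j = w j i) ->
  (forall i j, adj i j -> (sigma i j = 1 \/ sigma i j = -1) /\ sigma i j = sigma j i) ->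
  (forall i, 0 < mu i) ->
  (1 <= k <= n)%N ->
  1 <= q ->
  (2 `^ (- p) * var_eig adj w sigma mu kappa k p) @[p --> +oo]
      --> minmax_qinf adj w sigma mu k q
  /\ exists B, genus_family (sphere_p mu q) k B
       /\ (forall g, B g -> rayleigh_qinf adj w sigma mu q g
                            <= minmax_qinf adj w sigma mu k q)
       /\ (exists g, B g /\ rayleigh_qinf adj w sigma mu q g
                            = minmax_qinf adj w sigma mu k q).
Proof.
move=> _ _ wP sigmaP mu_gt0 kn q1; have q0 : 0 < q by exact: lt_le_trans q1.
have w_gt0 i j : adj i j -> 0 < w i j by move=> /wP[].
have sigma1 i j : adj i j -> sigma i j = 1 \/ sigma i j = -1 by move=> /sigmaP[].
split.
  have [C C0 HC] := var_eig_approx kappa w_gt0 sigma1 mu_gt0 q0 kn.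
  apply/cvgrPdist_le => e e0.
  have : \forall p \near +oo, Num.max 2 (C / e) <= p.
    by apply: nbhs_pinfty_ge; exact: num_real.
  apply: filterS => p; rewrite ge_max => /andP[p2 pC].
  have p0 : 0 < p by exact: lt_le_trans p2.
  by apply: (le_trans (HC p p2)); rewrite ler_pdivrMr// mulrC -ler_pdivrMr.
have GFS (B : set 'rV[R]_n) g : genus_family (sphere_p mu q) k B -> B g ->
    rayleigh_qinf adj w sigma mu q g = qinf_energy adj w sigma q g.
  by move=> [BS _ _ _] /BS; exact: rayleigh_qinf_sphere.
have [k0 kn'] := andP kn.
have [] := @minmax_attained R n (sphere_p mu q) (qinf_energy adj w sigma q) k k0.
- exact: sphere_compact.
- exact: sphere_closed.
- exact: sphere_symmetric.
- exact: continuous_qinf_energy.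
- exact: qinf_energyN.
- by exists (sphere_p mu q); exact: genus_family_sphere.
- by move=> B; exact: genus_family_nonempty.
(* On members of the family the quotient equals [qinf_energy], so both have the same min-max
   value. *)
move=> B; rewrite (_ : inf _ = minmax_qinf adj w sigma mu k q); last first.
  congr inf; apply: eq_imagel => D GD; congr sup; apply: eq_imagel => g Dg.
  by rewrite (GFS D).
move=> [GB Ble [g Bg gE]]; exists B; split=> //; split=> [f Bf|].
  by rewrite (GFS B)// Ble.
by exists g; split=> //; rewrite (GFS B).
Qed.
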